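(* Let $B$ be a finite Blaschke product and let $f:\mathbb{D}\to\mathbb{D}$ be a holomorphic function such that $B$ is a (finite) maximal Blaschke product for $f$. Let $\xi\in\partial\mathbb{D}$. If there is a sequence $(z_n)\subseteq\mathbb{D}$ such that $z_n\to\xi$ non-tangentially as $n\to\infty$ and $$f(z_n)=B(z_n)+o\big(|\xi-z_n|^3\big)\quad\text{as }n\to\infty,$$ then $f(z)=B(z)$ for all $z\in\mathbb{D}$.
   Context: $\mathbb{D}=\{z\in\mathbb{C}: |z|<1\}$ is the open unit disk. Critical points: a point $z\in\mathbb{D}$ is a critical point of multiplicity $m$ of a holomorphic $f:\mathbb{D}\to\mathbb{D}$ if it is a zero of multiplicity $m$ of $f'$. $\mathcal{C}_f$ denotes the collection of critical points of $f$ counting multiplicities. ''$\mathcal{C}_B$ is a subcollection of $\mathcal{C}_f$'' means that every critical point of $B$ is a critical point of $f$ with at least the same multiplicity. Maximal Blaschke product (MBP): let $f:\mathbb{D}\to\mathbb{D}$ be holomorphic. A (finite or infinite) Blaschke product $B$, regarded as a holomorphic self-map of $\mathbb{D}$, is called a maximal Blaschke product for $f$ if $\mathcal{C}_B$ is a subcollection of $\mathcal{C}_f$ and $$\frac{|g'(z)|}{1-|g(z)|^2}\le\frac{|B'(z)|}{1-|B(z)|^2}\qquad\text{for all }z\in\mathbb{D}$$ for every holomorphic function $g:\mathbb{D}\to\mathbb{D}$ such that $\mathcal{C}_B$ is also a subcollection of $\mathcal{C}_g$. Non-tangential convergence: let $d_{\mathbb{D}}(z,w)=2\tanh^{-1}\left|\frac{z-w}{1-\overline{z}w}\right|$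 be the hyperbolic distance, and for $m>0$ let $S(m,\xi)=\{z\in\mathbb{D}: d_{\mathbb{D}}(z,(\xi,-\xi)_h)<m\}$, where $(\xi,-\xi)_h$ is the hyperbolic geodesic line with end points $\xi$ and $-\xi$ (the diameter $\{t\xi:-1<t<1\}$). A sequence $(z_n)\subseteq\mathbb{D}$ converges to $\xi$ non-tangentially if $z_n\to\xi$ and there is $m>0$ such that $z_n\in S(m,\xi)$ for all sufficiently large $n$. *)

(* Defs.v *)
From Stdlib Require Import Reals List.
From Coquelicot Require Import Coquelicot.
Open Scope R_scope.

(* Holomorphic functions on the disk are represented by total functions
   [C -> C].  As [disk] is open, [C_derive f z] for [z] in [disk] depends only
   on the values of [f] in [disk], so the values outside are irrelevant. *)
Definition disk (z : C) : Prop := Cmod z < 1.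

Definition holomorphic_disk (f : C -> C) : Prop :=
  forall z : C, disk z -> ex_derive (K := C_AbsRing) (V := C_NormedModule) f z.

Definition self_map_disk (f : C -> C) : Prop :=
  holomorphic_disk f /\ forall z : C, disk z -> disk (f z).

Definition C_derive_n (f : C -> C) (n : nat) : C -> C :=
  Nat.iter n C_derive f.

Definition zero_order_ge (g : C -> C) (z : C) (m : nat) : Prop :=
  forall k : nat, (k < m)%nat -> C_derive_n g k z = 0%C.

Definition zero_of_multiplicity (g : C -> C) (z : C) (m : nat) : Prop :=
  (1 <= m)%nat /\ zero_order_ge g z m /\ C_derive_n g m z <> 0%C.

Definition critical_point (f : C -> C) (z : C) (m : nat) : Prop :=
  disk z /\ zero_of_multiplicity (C_derive f) z m.

(* If [f] is constant, every point of the disk counts as a critical point of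
   [f] of infinite multiplicity, whence [zero_order_ge] in the conclusion. *)
Definition critical_subcollection (B f : C -> C) : Prop :=
  forall (z : C) (m : nat), critical_point B z m ->
    zero_order_ge (C_derive f) z m.

Definition blaschke_factor (a z : C) : C :=
  ((z - a) / (1 - Cconj a * z))%C.

(* The empty list gives unimodular constants; as these do not map the disk
   into itself, [maximal_blaschke_product] excludes them. *)
Definition finite_blaschke_product (B : C -> C) : Prop :=
  exists (c : C) (l : list C),
    Cmod c = 1 /\ List.Forall disk l /\
    forall z : C, disk z ->
      B z = (c * fold_right (fun a p => blaschke_factor a z * p) 1 l)%C.

Fixpoint blaschke_partial (a : nat -> C) (n : nat) (z : C) : C :=
  match n with
  | O => 1%C
  | S k => (blaschke_partial a k z *
              (- (Cconj (a k) / Cmod (a k)) * blaschke_factor (a k) z))%C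
  end.

(* The zeros at the origin are split off, as the normalizing constants
   [- conj a / |a|] of the other factors make no sense for [a = 0]. *)
Definition infinite_blaschke_product (B : C -> C) : Prop :=
  exists (c : C) (m : nat) (a : nat -> C),
    Cmod c = 1 /\
    (forall n : nat, disk (a n) /\ a n <> 0%C) /\
    ex_series (fun n => 1 - Cmod (a n)) /\
    forall z : C, disk z ->
      filterlim (fun n => (c * z ^ m * blaschke_partial a n z)%C)
        eventually (locally (B z)).

Definition blaschke_product (B : C -> C) : Prop :=
  finite_blaschke_product B \/ infinite_blaschke_product B.

Definition hyp_deriv (f : C -> C) (z : C) : R :=
  Cmod (C_derive f z) / (1 - Cmod (f z) ^ 2).

Definition maximal_blaschke_product (B f : C -> C) : Prop :=
  blaschke_product B /\ self_map_disk B /\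
  critical_subcollection B f /\
  forall g : C -> C, self_map_disk g -> critical_subcollection B g ->
    forall z : C, disk z -> hyp_deriv g z <= hyp_deriv B z.

Definition artanh (x : R) : R := / 2 * ln ((1 + x) / (1 - x)).

Definition hyp_dist (z w : C) : R :=
  2 * artanh (Cmod ((z - w) / (1 - Cconj z * w))%C).

Definition hyp_dist_set (z : C) (A : C -> Prop) : Rbar :=
  Glb_Rbar (fun d : R => exists w : C, A w /\ d = hyp_dist z w).

Definition diameter (xi w : C) : Prop :=
  exists t : R, -1 < t < 1 /\ w = (t * xi)%C.

Definition stolz (m : R) (xi z : C) : Prop :=
  disk z /\ Rbar_lt (hyp_dist_set z (diameter xi)) m.

Definition nontangential_lim (z : nat -> C) (xi : C) : Prop :=
  filterlim z eventually (locally xi) /\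
  exists m : R, 0 < m /\ eventually (fun n => stolz m xi (z n)).

(* Main.v *)
(* Idea. Let [eta = B xi]. Maximality with [g = f] says that [f] contracts the
   hyperbolic metric at least as much as [B] does.  Since [B] extends
   analytically across the circle with [B' xi <> 0], it has a local inverse [psi]
   near [eta], and [phi = f o psi], read in the upper half plane with [eta] at
   infinity, is a map [{Im W > R0} -> {Im W > 0}] with [|phi'| / Im phi <= 1 / Im W].
   Integrating this along vertical and horizontal lines gives [Im phi >= c Im W],
   where [c] is the slope of [Im phi] at infinity, and Harnack's inequality for
   [Im (phi - c W)] identifies [c] with the slope along the given non-tangential
   sequence, that is [c = 1].  So [Im (phi - W)] is a nonnegative harmonic
   function, which is [o (1 / |W|)] along the sequence by the hypothesis of order 3;
   by Harnack's inequality (Hopf's lemma) it vanishes.  Hence [f = B] on an open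
   set, and then on the disk.
   The maximum principle, from which the Schwarz lemma, Harnack's inequality and the
   identity theorem are derived, rests on Goursat's theorem in the coordinate [log z],
   as [f] is only assumed to be complex differentiable. *)

Require Import Defs.
From Stdlib Require Import Reals.
From Coquelicot Require Import Coquelicot.
From Stdlib Require Import List Lra Lia Classical ClassicalChoice.
Open Scope R_scope.

(** * Complex derivatives *)

Notation is_Cderive := (is_derive (K := C_AbsRing) (V := C_NormedModule)).
Notation ex_Cderive := (ex_derive (K := C_AbsRing) (V := C_NormedModule)).

(** As [phi] is defined only on [Im W > R0], the Schwarz-Pick lemma for [f] alone would bound
    [|phi'| / Im phi] by [1 / (Im W - R0)]. Integration would then give [Im phi >= c (Im W - R0)],
    and [Im (phi - W)] would have no definite sign. Maximality, applied to the single competitor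
    [f], gives the bound [1 / Im W] without this loss. The exponent 3 is consumed as follows. Put
    [s = |xi - z|]. The transform [cay eta] has size [1 / s] at [B z], and [cay eta (f z) - cay eta
    (B z) = 2 i eta (f z - B z) / ((eta - f z) (eta - B z))] has size [|f z - B z| / s^2]. So
    [|W| |phi W - W|] has size [|f z - B z| / s^3]. Non-tangential approach becomes [|W| <= K Im W].
    This is what makes Harnack's inequality lose only a constant factor when a term of the sequence
    is compared with a fixed point, or with the point of the imaginary axis at the same height. *)

Lemma is_Cderive_eps (f : C -> C) (z l : C) :
  is_Cderive f z l <->
  forall eps : R, 0 < eps -> exists delta : R, 0 < delta /\
    forall w : C, Cmod (w - z)%C < delta ->
      Cmod (f w - f z - l * (w - z))%C <= eps * Cmod (w - z)%C.
Proof.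
  split.
  - intros [_ H] eps Heps.
    destruct (H z (fun P HP => HP) (mkposreal eps Heps)) as [d Hd].
    exists d; split; [apply cond_pos|]. intros w Hw.
    specialize (Hd w Hw).
    change (Cmod (f w - f z - (w - z) * l)%C <= eps * Cmod (w - z)%C) in Hd.
    rewrite Cmult_comm in Hd. exact Hd.
  - intros H. split. apply is_linear_scal_l.
    intros y Hy.
    apply (is_filter_lim_locally_unique (K := C_AbsRing) (V := AbsRing_NormedModule C_AbsRing)) in Hy.
    change (z = y) in Hy. subst y.
    intros eps. destruct (H eps (cond_pos eps)) as [d [Hd1 Hd]].
    exists (mkposreal d Hd1). intros w Hw. specialize (Hd w Hw).
    change (Cmod (f w - f z - (w - z) * l)%C <= eps * Cmod (w - z)%C).
    rewrite (Cmult_comm _ l). exact Hd.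
Qed.

(** [C] carries two normed module structures over itself with the same norm. The general rules for
    products and for the inner function of a composition are stated for the one on the left. *)
Lemma is_Cderive_ring (f : C -> C) (z l : C) :
  is_derive (K := C_AbsRing) (V := AbsRing_NormedModule C_AbsRing) f z l <->
  is_Cderive f z l.
Proof.
  split; intros [H1 H2]; split; try apply is_linear_scal_l; exact H2.
Qed.

Lemma is_Cderive_ext_loc (f g : C -> C) (z l : C) (r : R) : 0 < r ->
  (forall w, Cmod (w - z)%C < r -> f w = g w) -> is_Cderive f z l -> is_Cderive g z l.
Proof.
  intros Hr E H. rewrite is_Cderive_eps in *. intros eps He.
  destruct (H eps He) as [d [Hd1 Hd]].
  exists (Rmin d r); split; [now apply Rmin_pos|]. intros w Hw.
  rewrite <- (E w), <- (E z).
  - apply Hd. eapply Rlt_le_trans; [exact Hw|apply Rmin_l].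
  - replace (z - z)%C with (RtoC 0) by ring. rewrite Cmod_0; exact Hr.
  - eapply Rlt_le_trans; [exact Hw|apply Rmin_r].
Qed.

Lemma is_Cderive_id (z : C) : is_Cderive (fun w => w) z (RtoC 1).
Proof. apply is_Cderive_ring. exact (is_derive_id (K := C_AbsRing) z). Qed.

Lemma is_Cderive_const (c z : C) : is_Cderive (fun _ => c) z (RtoC 0).
Proof. exact (is_derive_const (K := C_AbsRing) (V := C_NormedModule) c z). Qed.

Lemma is_Cderive_plus (f g : C -> C) (z a b : C) :
  is_Cderive f z a -> is_Cderive g z b -> is_Cderive (fun w => f w + g w)%C z (a + b)%C.
Proof. exact (is_derive_plus (K := C_AbsRing) (V := C_NormedModule) f g z a b). Qed.

Lemma is_Cderive_minus (f g : C -> C) (z a b : C) :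
  is_Cderive f z a -> is_Cderive g z b -> is_Cderive (fun w => f w - g w)%C z (a - b)%C.
Proof. exact (is_derive_minus (K := C_AbsRing) (V := C_NormedModule) f g z a b). Qed.

Lemma is_Cderive_mult (f g : C -> C) (z a b : C) :
  is_Cderive f z a -> is_Cderive g z b ->
  is_Cderive (fun w => f w * g w)%C z (a * g z + f z * b)%C.
Proof.
  rewrite <- !is_Cderive_ring. intros Hf Hg.
  exact (is_derive_mult (K := C_AbsRing) f g z a b Hf Hg Cmult_comm).
Qed.

Lemma is_Cderive_comp (f g : C -> C) (z a b : C) :
  is_Cderive f (g z) a -> is_Cderive g z b -> is_Cderive (fun w => f (g w)) z (a * b)%C.
Proof.
  intros Hf Hg. rewrite <- is_Cderive_ring in Hg.
  rewrite Cmult_comm.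
  exact (is_derive_comp (K := C_AbsRing) (V := C_NormedModule) f g z a b Hf Hg).
Qed.

Lemma Cmod_sub_sym (a b : C) : Cmod (a - b)%C = Cmod (b - a)%C.
Proof. rewrite <- Cmod_opp. f_equal. ring. Qed.

Lemma Cmod_triangle_sub (a b : C) : Cmod a - Cmod b <= Cmod (a - b)%C.
Proof.
  generalize (Cmod_triangle (a - b)%C b). replace (a - b + b)%C with a by ring. lra.
Qed.

Lemma Cmod_sub_le (a b : C) : Cmod (a - b)%C <= Cmod a + Cmod b.
Proof. rewrite <- (Cmod_opp b). apply Cmod_triangle. Qed.

Lemma Cmod_neq_0 (a : C) : 0 < Cmod a -> a <> 0%C.
Proof. apply Cmod_gt_0. Qed.

Lemma is_Cderive_inv_id (z : C) : z <> 0%C -> is_Cderive (fun w => / w)%C z (- / (z * z))%C.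
Proof.
  intros Hz. apply Cmod_gt_0 in Hz as Hm. apply is_Cderive_eps. intros eps He.
  set (m := Cmod z) in *.
  (* The first bound keeps [|w| >= m / 2]. The remainder [(w - z)^2 / (w z^2)] is then at most
     [2 |w - z|^2 / m^3], whence the second bound. *)
  exists (Rmin (m / 2) (eps * (m * m * m) / 2)). split.
  { apply Rmin_pos; [lra|]. apply Rdiv_lt_0_compat; [|lra].
    repeat apply Rmult_lt_0_compat; assumption. }
  intros w Hw.
  assert (H1 : Cmod (w - z)%C < m / 2) by (eapply Rlt_le_trans; [exact Hw|apply Rmin_l]).
  assert (H2 : Cmod (w - z)%C < eps * (m * m * m) / 2)
    by (eapply Rlt_le_trans; [exact Hw|apply Rmin_r]).
  assert (Hwm : m / 2 <= Cmod w).
  { generalize (Cmod_triangle_sub z w). rewrite Cmod_sub_sym. fold m. lra. }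
  assert (Hw0 : w <> 0%C) by (apply Cmod_neq_0; lra).
  replace (/ w - / z - - / (z * z) * (w - z))%C
    with ((w - z) * (w - z) / (w * (z * z)))%C by (field; auto).
  rewrite Cmod_div by (repeat apply Cmult_neq_0; auto).
  rewrite !Cmod_mult. fold m.
  set (u := Cmod (w - z)%C) in *. set (v := Cmod w) in *.
  assert (0 <= u) by apply Cmod_ge_0.
  assert (0 < m * m) by nra.
  apply Rmult_le_reg_r with (v * (m * m)); [nra|].
  unfold Rdiv. rewrite Rmult_assoc, Rinv_l by nra.
  rewrite Rmult_1_r.
  assert (u <= eps * (v * (m * m))) by nra.
  nra.
Qed.

Lemma is_Cderive_inv (f : C -> C) (z a : C) :
  is_Cderive f z a -> f z <> 0%C -> is_Cderive (fun w => / f w)%C z (- a / (f z * f z))%C.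
Proof.
  intros Hf H0.
  replace (- a / (f z * f z))%C with (- / (f z * f z) * a)%C by (field; auto).
  apply (is_Cderive_comp (fun w => / w)%C f); [now apply is_Cderive_inv_id|assumption].
Qed.

Lemma is_Cderive_div (f g : C -> C) (z a b : C) :
  is_Cderive f z a -> is_Cderive g z b -> g z <> 0%C ->
  is_Cderive (fun w => f w / g w)%C z ((a * g z - f z * b) / (g z * g z))%C.
Proof.
  intros Hf Hg H0.
  replace ((a * g z - f z * b) / (g z * g z))%C
    with (a * / g z + f z * (- b / (g z * g z)))%C by (field; auto).
  apply (is_Cderive_mult f (fun w => / g w)%C); [assumption|now apply is_Cderive_inv].
Qed.

Lemma is_Cderive_pow (f : C -> C) (z a : C) (n : nat) :
  is_Cderive f z a -> ex_Cderive (fun w => f w ^ n)%C z.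
Proof.
  intros H. induction n as [|n [b IH]].
  - exists (RtoC 0). apply (is_Cderive_const (RtoC 1)).
  - eexists. apply (is_Cderive_mult f (fun w => f w ^ n)%C); eassumption.
Qed.

Lemma is_Cderive_continuous (f : C -> C) (z l : C) : is_Cderive f z l ->
  forall eps : R, 0 < eps -> exists delta : R, 0 < delta /\
    forall w : C, Cmod (w - z)%C < delta -> Cmod (f w - f z)%C < eps.
Proof.
  intros H eps He. rewrite is_Cderive_eps in H.
  destruct (H 1 Rlt_0_1) as [d [Hd1 Hd]].
  assert (HL : 0 <= Cmod l) by apply Cmod_ge_0.
  exists (Rmin d (eps / (Cmod l + 2))). split.
  { apply Rmin_pos; [assumption|]. apply Rdiv_lt_0_compat; lra. }
  intros w Hw.
  assert (H1 : Cmod (w - z)%C < d) by (eapply Rlt_le_trans; [exact Hw|apply Rmin_l]).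
  assert (H2 : Cmod (w - z)%C < eps / (Cmod l + 2))
    by (eapply Rlt_le_trans; [exact Hw|apply Rmin_r]).
  specialize (Hd w H1).
  replace (f w - f z)%C with ((f w - f z - l * (w - z)) + l * (w - z))%C by ring.
  eapply Rle_lt_trans; [apply Cmod_triangle|]. rewrite Cmod_mult.
  apply Rmult_lt_compat_r with (r := Cmod l + 2) in H2; [|lra].
  unfold Rdiv in H2. rewrite Rmult_assoc, Rinv_l, Rmult_1_r in H2 by lra.
  assert (0 <= Cmod (w - z)%C) by apply Cmod_ge_0. nra.
Qed.

(** The factor [c] selects a real component: the conjugate of the increment in the mean value
    inequality, [- Ci] for imaginary parts. *)
Lemma is_derive_line (f : C -> C) (p d c l : C) (t : R) :
  is_Cderive f (p + t * d)%C l ->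
  is_derive (fun s : R => Re (c * f (p + s * d))%C) t (Re (c * l * d)%C).
Proof.
  intros H. apply is_derive_Reals. intros eps He.
  assert (Hc : 0 <= Cmod c) by apply Cmod_ge_0.
  assert (Hd : 0 <= Cmod d) by apply Cmod_ge_0.
  rewrite is_Cderive_eps in H.
  set (k := (Cmod c + 1) * (Cmod d + 1)). assert (Hk : 0 < k) by (unfold k; nra).
  destruct (H (eps / (2 * k))) as [del [H1 H2]].
  { apply Rdiv_lt_0_compat; lra. }
  assert (Hp : 0 < del / (Cmod d + 1)) by (apply Rdiv_lt_0_compat; lra).
  exists (mkposreal _ Hp). intros h Hh0 Hh. simpl in Hh.
  specialize (H2 (p + (t + h)%R * d)%C).
  replace (p + (t + h)%R * d - (p + t * d))%C with (h * d)%C in H2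
    by (rewrite RtoC_plus; ring).
  rewrite Cmod_mult, Cmod_R in H2.
  assert (Ha : 0 < Rabs h) by now apply Rabs_pos_lt.
  assert (Hlt : Rabs h * Cmod d < del).
  { apply Rmult_lt_compat_r with (r := Cmod d + 1) in Hh; [|lra].
    unfold Rdiv in Hh. rewrite Rmult_assoc, Rinv_l, Rmult_1_r in Hh by lra. nra. }
  specialize (H2 Hlt).
  set (u := (f (p + (t + h)%R * d) - f (p + t * d) - l * (h * d))%C) in *.
  replace ((Re (c * f (p + (t + h)%R * d))%C - Re (c * f (p + t * d))%C) / h
           - Re (c * l * d)%C) with (Re (c * u)%C / h).
  2:{ replace (c * f (p + (t + h)%R * d))%C
        with (c * u + c * f (p + t * d) + h * (c * l * d))%C by (unfold u; ring).
      rewrite !re_plus, re_scal_l. field. assumption. }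
  unfold Rdiv. rewrite Rabs_mult, Rabs_inv.
  apply Rmult_lt_reg_r with (Rabs h); [assumption|].
  rewrite Rmult_assoc, Rinv_l, Rmult_1_r by lra.
  eapply Rle_lt_trans; [apply re_le_Cmod|]. rewrite Cmod_mult.
  eapply Rle_lt_trans; [apply Rmult_le_compat_l; [exact Hc|exact H2]|].
  replace (Cmod c * (eps / (2 * k) * (Rabs h * Cmod d)))
    with (eps * Rabs h * ((Cmod c * Cmod d) / k) / 2) by (field; lra).
  assert (Hq : Cmod c * Cmod d / k < 1).
  { apply Rmult_lt_reg_r with k; [assumption|].
    unfold Rdiv. rewrite Rmult_assoc, Rinv_l by lra. unfold k. nra. }
  assert (0 < eps * Rabs h) by now apply Rmult_lt_0_compat.
  nra.
Qed.

(** The real mean value theorem is applied to the component of [f] in the direction of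
    [u = f b - f a], whose increment is [|u|^2]. *)
Lemma mean_value_Cmod (f f' : C -> C) (a b : C) (k : R) :
  (forall t : R, 0 <= t <= 1 ->
     is_Cderive f (a + t * (b - a))%C (f' (a + t * (b - a))%C) /\
     Cmod (f' (a + t * (b - a))%C) <= k) ->
  Cmod (f b - f a)%C <= k * Cmod (b - a)%C.
Proof.
  intros H. set (u := (f b - f a)%C).
  set (h := fun s : R => Re (Cconj u * f (a + s * (b - a)))%C).
  assert (Hd : forall t, 0 <= t <= 1 ->
    is_derive h t (Re (Cconj u * f' (a + t * (b - a)) * (b - a))%C)).
  { intros t Ht. apply is_derive_line. now apply H. }
  destruct (MVT_gen h 0 1 (fun t => Re (Cconj u * f' (a + t * (b - a)) * (b - a))%C))
    as [t [Ht E]].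
  - rewrite Rmin_left, Rmax_right by lra. intros x Hx. apply Hd. lra.
  - rewrite Rmin_left, Rmax_right by lra. intros x Hx.
    apply derivable_continuous_pt. eexists. apply is_derive_Reals. now apply Hd.
  - rewrite Rmin_left, Rmax_right in Ht by lra.
    unfold h in E at 1 2.
    replace (a + 1%R * (b - a))%C with b in E by ring.
    replace (a + 0%R * (b - a))%C with a in E by ring.
    assert (E2 : Cmod u ^ 2 <= Cmod u * (k * Cmod (b - a)%C)).
    { replace (Cmod u ^ 2) with (Re (Cconj u * f b)%C - Re (Cconj u * f a)%C).
      2:{ rewrite Cmod2_alt. unfold u. destruct (f a), (f b). simpl. ring. }
      rewrite E, Rminus_0_r, Rmult_1_r.
      eapply Rle_trans; [apply Rle_abs|].
      eapply Rle_trans; [apply re_le_Cmod|].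
      rewrite !Cmod_mult, Cmod_conj, Rmult_assoc.
      apply Rmult_le_compat_l; [apply Cmod_ge_0|].
      apply Rmult_le_compat_r; [apply Cmod_ge_0|]. now apply H. }
    assert (Hu : 0 <= Cmod u) by apply Cmod_ge_0.
    assert (Hk : 0 <= k * Cmod (b - a)%C).
    { apply Rmult_le_pos; [|apply Cmod_ge_0].
      eapply Rle_trans; [apply Cmod_ge_0|]. now apply (H t). }
    destruct Hu as [Hu|Hu]; [nra|]. rewrite <- Hu. exact Hk.
Qed.

(** * Goursat's theorem *)

Notation RIntC := (RInt (V := C_R_CompleteNormedModule)).
Notation ex_RIntC := (ex_RInt (V := C_R_CompleteNormedModule)).
Notation is_RIntC := (is_RInt (V := C_R_CompleteNormedModule)).

Lemma continuous_line (F : C -> C) (p d : C) (t : R) :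
  ex_Cderive F (p + t * d)%C ->
  continuous (U := C_R_CompleteNormedModule) (fun s : R => F (p + s * d)%C) t.
Proof.
  intros [l Hl]. apply (proj2 (filterlim_locally _ _)). intros eps.
  destruct (is_Cderive_continuous F _ l Hl eps (cond_pos eps)) as [del [H1 H2]].
  assert (Hd : 0 <= Cmod d) by apply Cmod_ge_0.
  assert (Hp : 0 < del / (Cmod d + 1)) by (apply Rdiv_lt_0_compat; lra).
  exists (mkposreal _ Hp). intros s Hs.
  change (Rabs (s - t) < del / (Cmod d + 1)) in Hs.
  apply C_NormedModule_mixin_compat1. apply H2.
  replace (p + s * d - (p + t * d))%C with ((s - t)%R * d)%C
    by (rewrite RtoC_minus; ring).
  rewrite Cmod_mult, Cmod_R.
  apply Rmult_lt_compat_r with (r := Cmod d + 1) in Hs; [|lra].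
  unfold Rdiv in Hs. rewrite Rmult_assoc, Rinv_l, Rmult_1_r in Hs by lra.
  assert (0 <= Rabs (s - t)) by apply Rabs_pos. nra.
Qed.

Lemma ex_RInt_line (F : C -> C) (p d : C) (a b : R) : a <= b ->
  (forall t, a <= t <= b -> ex_Cderive F (p + t * d)%C) ->
  ex_RIntC (fun s : R => F (p + s * d)%C) a b.
Proof.
  intros Hab H. apply ex_RInt_continuous. intros t Ht.
  rewrite Rmin_left, Rmax_right in Ht by assumption.
  now apply continuous_line, H.
Qed.

Lemma is_RInt_affine (A B : C) (a b : R) :
  is_RIntC (fun t : R => (A + t * B)%C) a b
    ((b - a)%R * A + ((b ^ 2 - a ^ 2) / 2)%R * B)%C.
Proof.
  apply is_RInt_fct_extend_pair.
  - match goal with |- is_RInt _ _ _ ?l => replace l with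
      (minus (b * fst A + b ^ 2 / 2 * fst B) (a * fst A + a ^ 2 / 2 * fst B)) end.
    2:{ unfold minus, plus, opp. simpl. field. }
    apply (is_RInt_derive (fun t => t * fst A + t ^ 2 / 2 * fst B)).
    + intros x _. auto_derive; [trivial|]. simpl. field.
    + intros x _. simpl. apply (ex_derive_continuous (V := R_NormedModule)). auto_derive. trivial.
  - match goal with |- is_RInt _ _ _ ?l => replace l with
      (minus (b * snd A + b ^ 2 / 2 * snd B) (a * snd A + a ^ 2 / 2 * snd B)) end.
    2:{ unfold minus, plus, opp. simpl. field. }
    apply (is_RInt_derive (fun t => t * snd A + t ^ 2 / 2 * snd B)).
    + intros x _. auto_derive; [trivial|]. simpl. field.
    + intros x _. simpl. apply (ex_derive_continuous (V := R_NormedModule)). auto_derive. trivial.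
Qed.

Lemma RInt_line_bound (F : C -> C) (p d : C) (a b M : R) : a <= b ->
  ex_RIntC (fun s : R => F (p + s * d)%C) a b ->
  (forall t, a <= t <= b -> Cmod (F (p + t * d)%C) <= M) ->
  Cmod (RIntC (fun s : R => F (p + s * d)%C) a b) <= (b - a) * M.
Proof.
  intros Hab [I HI] HM. rewrite (is_RInt_unique _ _ _ _ HI).
  rewrite Cmod_norm.
  apply (norm_RInt_le_const (V := C_R_NormedModule) (fun s : R => F (p + s * d)%C));
    [assumption| |exact HI].
  intros x Hx. rewrite <- Cmod_norm. now apply HM.
Qed.

(** Affine functions are integrated exactly, so only the deviation from [u + v z] contributes.
    Goursat's theorem uses the tangent map, the mean value property the constant [f 0], with
    [v = 0]. *)
Lemma RInt_line_affine_error (F : C -> C) (p d u v : C) (a b M : R) : a <= b ->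
  ex_RIntC (fun s : R => F (p + s * d)%C) a b ->
  (forall t, a <= t <= b -> Cmod (F (p + t * d) - (u + v * (p + t * d)))%C <= M) ->
  Cmod (RIntC (fun s : R => F (p + s * d)%C) a b
        - ((b - a)%R * (u + v * p) + ((b ^ 2 - a ^ 2) / 2)%R * (v * d)))%C <= (b - a) * M.
Proof.
  intros Hab [I HI] HM. rewrite (is_RInt_unique _ _ _ _ HI).
  rewrite Cmod_norm.
  apply (norm_RInt_le_const (V := C_R_NormedModule)
    (fun s : R => (F (p + s * d) - (u + v * p + s * (v * d)))%C)); [assumption| |].
  - intros x Hx. rewrite <- Cmod_norm.
    replace (u + v * p + x * (v * d))%C with (u + v * (p + x * d))%C by ring.
    now apply HM.
  - exact (is_RInt_minus (V := C_R_NormedModule) _ _ _ _ _ _ HI (is_RInt_affine _ _ _ _)).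
Qed.

(** The counterclockwise contour integral. Each side is written as [p + s * d], so that the lemmas
    on lines apply to all four. *)
Definition rect_int (F : C -> C) (a b c d : R) : C :=
  (RIntC (fun x : R => F (Ci * c + x * 1)) a b - RIntC (fun x : R => F (Ci * d + x * 1)) a b
   + Ci * (RIntC (fun y : R => F (b + y * Ci)) c d - RIntC (fun y : R => F (a + y * Ci)) c d))%C.

Definition holo_rect (F : C -> C) (a b c d : R) : Prop :=
  forall x y : R, a <= x <= b -> c <= y <= d -> ex_Cderive F (x + y * Ci)%C.

Lemma holo_rect_horizontal (F : C -> C) (a b c d y x1 x2 : R) :
  holo_rect F a b c d -> c <= y <= d -> a <= x1 -> x1 <= x2 -> x2 <= b ->
  ex_RIntC (fun x : R => F (Ci * y + x * 1)%C) x1 x2.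
Proof.
  intros H Hy H1 H2 H3. apply ex_RInt_line; [assumption|]. intros t Ht.
  replace (Ci * y + t * 1)%C with (t + y * Ci)%C by ring. apply H; lra.
Qed.

Lemma holo_rect_vertical (F : C -> C) (a b c d x y1 y2 : R) :
  holo_rect F a b c d -> a <= x <= b -> c <= y1 -> y1 <= y2 -> y2 <= d ->
  ex_RIntC (fun y : R => F (x + y * Ci)%C) y1 y2.
Proof.
  intros H Hy H1 H2 H3. apply ex_RInt_line; [assumption|]. intros t Ht. apply H; lra.
Qed.

Lemma rect_int_split_x (F : C -> C) (a m b c d : R) :
  a <= m <= b -> c <= d -> holo_rect F a b c d ->
  rect_int F a b c d = (rect_int F a m c d + rect_int F m b c d)%C.
Proof.
  intros Hm Hcd H. unfold rect_int.
  rewrite <- (RInt_Chasles (V := C_R_CompleteNormedModule) (fun x : R => F (Ci * c + x * 1)%C) a m b)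
    by (apply (holo_rect_horizontal F a b c d); lra || assumption).
  rewrite <- (RInt_Chasles (V := C_R_CompleteNormedModule) (fun x : R => F (Ci * d + x * 1)%C) a m b)
    by (apply (holo_rect_horizontal F a b c d); lra || assumption).
  change (@plus C_R_CompleteNormedModule) with Cplus. ring.
Qed.

Lemma rect_int_split_y (F : C -> C) (a b c m d : R) :
  a <= b -> c <= m <= d -> holo_rect F a b c d ->
  rect_int F a b c d = (rect_int F a b c m + rect_int F a b m d)%C.
Proof.
  intros Hab Hm H. unfold rect_int.
  rewrite <- (RInt_Chasles (V := C_R_CompleteNormedModule) (fun y : R => F (a + y * Ci)%C) c m d)
    by (apply (holo_rect_vertical F a b c d); lra || assumption).
  rewrite <- (RInt_Chasles (V := C_R_CompleteNormedModule) (fun y : R => F (b + y * Ci)%C) c m d)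
    by (apply (holo_rect_vertical F a b c d); lra || assumption).
  change (@plus C_R_CompleteNormedModule) with Cplus. ring.
Qed.

(** The exact contributions of the affine part along the four sides cancel; what is left is the
    perimeter times [M]. *)
Lemma rect_int_affine_error (F : C -> C) (u v : C) (a b c d M : R) :
  a <= b -> c <= d -> holo_rect F a b c d ->
  (forall x y : R, a <= x <= b -> c <= y <= d ->
     Cmod (F (x + y * Ci) - (u + v * (x + y * Ci)))%C <= M) ->
  Cmod (rect_int F a b c d) <= 2 * ((b - a) + (d - c)) * M.
Proof.
  intros Hab Hcd H HM.
  assert (H1 : forall y, c <= y <= d ->
    Cmod (RIntC (fun x : R => F (Ci * y + x * 1)%C) a b
        - ((b - a)%R * (u + v * (Ci * y)) + ((b ^ 2 - a ^ 2) / 2)%R * (v * 1)))%C <= (b - a) * M).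
  { intros y Hy. apply RInt_line_affine_error; [assumption| |].
    - apply (holo_rect_horizontal F a b c d); lra || assumption.
    - intros t Ht. replace (Ci * y + t * 1)%C with (t + y * Ci)%C by ring. now apply HM. }
  assert (H2 : forall x, a <= x <= b ->
    Cmod (RIntC (fun y : R => F (x + y * Ci)%C) c d
        - ((d - c)%R * (u + v * x) + ((d ^ 2 - c ^ 2) / 2)%R * (v * Ci)))%C <= (d - c) * M).
  { intros x Hx. apply RInt_line_affine_error; [assumption| |].
    - apply (holo_rect_vertical F a b c d); lra || assumption.
    - intros t Ht. now apply HM. }
  unfold rect_int.
  generalize (H1 c ltac:(lra)) (H1 d ltac:(lra)) (H2 a ltac:(lra)) (H2 b ltac:(lra)).
  generalize (RIntC (fun x : R => F (Ci * c + x * 1)%C) a b)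
    (RIntC (fun x : R => F (Ci * d + x * 1)%C) a b)
    (RIntC (fun y : R => F (a + y * Ci)%C) c d)
    (RIntC (fun y : R => F (b + y * Ci)%C) c d).
  intros I1 I2 I3 I4 E1 E2 E3 E4.
  match type of E1 with Cmod ?x <= _ => set (J1 := x) in * end.
  match type of E2 with Cmod ?x <= _ => set (J2 := x) in * end.
  match type of E3 with Cmod ?x <= _ => set (J3 := x) in * end.
  match type of E4 with Cmod ?x <= _ => set (J4 := x) in * end.
  replace (I1 - I2 + Ci * (I4 - I3))%C with ((J1 - J2) + Ci * (J4 - J3))%C.
  2:{ unfold J1, J2, J3, J4.
      rewrite !RtoC_div, !RtoC_minus, !RtoC_pow by lra. field.
      }
  eapply Rle_trans; [apply Cmod_triangle|]. rewrite Cmod_mult, Cmod_Ci.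
  generalize (Cmod_sub_le J1 J2) (Cmod_sub_le J4 J3). lra.
Qed.

Lemma nested_intervals (x s : nat -> R) :
  (forall n, 0 <= s n) -> (forall n, x n <= x (S n) /\ x (S n) + s (S n) <= x n + s n) ->
  exists u, forall n, x n <= u <= x n + s n.
Proof.
  intros Hs Hx.
  assert (Hk : forall k n, x n <= x (k + n)%nat /\ x (k + n)%nat + s (k + n)%nat <= x n + s n).
  { induction k as [|k IH]; intros n; simpl; [lra|].
    destruct (IH n), (Hx (k + n)%nat). lra. }
  assert (Hb : forall m n, x m <= x n + s n).
  { intros m n. destruct (Hk m n), (Hk n m). rewrite (Nat.add_comm n m) in *.
    generalize (Hs (m + n)%nat). lra. }
  destruct (completeness (fun r => exists n, r = x n)) as [u [Hu1 Hu2]].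
  - exists (x 0%nat + s 0%nat). intros r [n ->]. apply Hb.
  - now exists (x 0%nat), 0%nat.
  - exists u. intros n. split.
    + apply Hu1. now exists n.
    + apply Hu2. intros r [m ->]. apply Hb.
Qed.

Lemma half_pow (w : R) (n : nat) : w / 2 ^ n = w / 2 ^ S n + w / 2 ^ S n.
Proof. simpl. field. apply pow_nonzero. lra. Qed.

Lemma div_pow2_nonneg (w : R) (n : nat) : 0 <= w -> 0 <= w / 2 ^ n.
Proof.
  intros H. apply Rmult_le_pos; [assumption|].
  apply Rlt_le, Rinv_0_lt_compat, pow_lt. lra.
Qed.

(* [P n x y] is a property of the rectangle with lower left corner [(x, y)] and
   sides [w / 2 ^ n], [h / 2 ^ n]. *)
Lemma rect_bisection (a c w h : R) (P : nat -> R -> R -> Prop) : 0 <= w -> 0 <= h ->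
  (forall n x y, a <= x -> x + w / 2 ^ n <= a + w -> c <= y -> y + h / 2 ^ n <= c + h ->
     P (S n) x y -> P (S n) (x + w / 2 ^ S n) y -> P (S n) x (y + h / 2 ^ S n) ->
     P (S n) (x + w / 2 ^ S n) (y + h / 2 ^ S n) -> P n x y) ->
  (forall u v, a <= u <= a + w -> c <= v <= c + h ->
     exists N, forall n x y, (N <= n)%nat ->
       a <= x -> x + w / 2 ^ n <= a + w -> c <= y -> y + h / 2 ^ n <= c + h ->
       x <= u <= x + w / 2 ^ n -> y <= v <= y + h / 2 ^ n -> P n x y) ->
  P 0%nat a c.
Proof.
  intros Hw Hh Hsub Hloc. apply NNPP. intros Hn.
  set (bad := fun n (q : R * R) => a <= fst q /\ fst q + w / 2 ^ n <= a + w /\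
     c <= snd q /\ snd q + h / 2 ^ n <= c + h /\ ~ P n (fst q) (snd q)).
  assert (step : forall nq : nat * (R * R), exists q' : R * R,
    bad (fst nq) (snd nq) -> bad (S (fst nq)) q' /\
      (fst (snd nq) <= fst q' /\ fst q' + w / 2 ^ S (fst nq) <= fst (snd nq) + w / 2 ^ fst nq) /\
      (snd (snd nq) <= snd q' /\ snd q' + h / 2 ^ S (fst nq) <= snd (snd nq) + h / 2 ^ fst nq)).
  { intros [n [x y]]. simpl fst; simpl snd.
    (* The choice function must be total; [(0, 0)] is a dummy value off the bad rectangles. *)
    destruct (classic (bad n (x, y))) as [Hb|Hb]; [|exists (0, 0); tauto].
    destruct Hb as (B1 & B2 & B3 & B4 & B5). simpl in B1, B2, B3, B4, B5.
    assert (Hw' := half_pow w n). assert (Hh' := half_pow h n).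
    assert (0 <= w / 2 ^ S n) by now apply div_pow2_nonneg.
    assert (0 <= h / 2 ^ S n) by now apply div_pow2_nonneg.
    set (w' := w / 2 ^ S n) in *. set (h' := h / 2 ^ S n) in *.
    assert (Q : ~ P (S n) x y \/ ~ P (S n) (x + w') y \/ ~ P (S n) x (y + h')
      \/ ~ P (S n) (x + w') (y + h')).
    { apply NNPP. intros Q. apply B5. apply Hsub; try assumption; apply NNPP; tauto. }
    destruct Q as [Q|[Q|[Q|Q]]];
      [exists (x, y)|exists (x + w', y)|exists (x, y + h')|exists (x + w', y + h')];
      intros _; unfold bad; simpl fst; simpl snd; fold w'; fold h';
      repeat split; try lra; assumption. }
  destruct (choice _ step) as [g Hg].
  set (q := fix q (n : nat) : R * R := match n with O => (a, c) | S k => g (k, q k) end).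
  assert (Hq : forall n, bad n (q n)).
  { induction n as [|n IH].
    - unfold bad. simpl. repeat split; try lra; assumption.
    - apply (Hg (n, q n) IH). }
  destruct (nested_intervals (fun n => fst (q n)) (fun n => w / 2 ^ n)) as [u Hu].
  { intros n. now apply div_pow2_nonneg. }
  { intros n. apply (Hg (n, q n) (Hq n)). }
  destruct (nested_intervals (fun n => snd (q n)) (fun n => h / 2 ^ n)) as [v Hv].
  { intros n. now apply div_pow2_nonneg. }
  { intros n. apply (Hg (n, q n) (Hq n)). }
  destruct (Hloc u v) as [N HN].
  - generalize (Hu 0%nat). simpl. lra.
  - generalize (Hv 0%nat). simpl. lra.
  - destruct (Hq N) as (B1 & B2 & B3 & B4 & B5). apply B5.
    now apply HN.
Qed.

Lemma pow2_small (w eps : R) : 0 < eps -> exists N, forall n, (N <= n)%nat -> w / 2 ^ n < eps.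
Proof.
  intros He. destruct (Rle_lt_dec w 0) as [Hw|Hw].
  { exists 0%nat. intros n _. assert (0 < / 2 ^ n) by (apply Rinv_0_lt_compat, pow_lt; lra).
    unfold Rdiv. nra. }
  destruct (Pow_x_infinity 2 ltac:(rewrite Rabs_right; lra) (w / eps + 1)) as [N HN].
  exists N. intros n Hn. specialize (HN n Hn).
  assert (Hp : 0 < 2 ^ n) by (apply pow_lt; lra).
  rewrite Rabs_right in HN by lra.
  apply Rmult_lt_reg_r with (2 ^ n); [assumption|].
  unfold Rdiv at 1. rewrite Rmult_assoc, Rinv_l, Rmult_1_r by lra.
  apply Rlt_le_trans with (eps * (w / eps + 1)); [|nra].
  replace (eps * (w / eps + 1)) with (w + eps) by (field; lra). lra.
Qed.

Lemma Cmod_re_im_le (z : C) : Cmod z <= Rabs (Re z) + Rabs (Im z).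
Proof.
  replace z with (Re z + Ci * Im z)%C at 1.
  - eapply Rle_trans; [apply Cmod_triangle|]. rewrite Cmod_mult, Cmod_Ci, !Cmod_R. lra.
  - destruct z. unfold Ci, Cplus, Cmult. simpl. f_equal; ring.
Qed.

(** The bound [eps * 2 (w + h)^2] is quadratic in the side lengths, so it passes from the four
    quarters to the whole rectangle with the same [eps]. Near a point it holds for small rectangles:
    there [F] differs from its tangent map by at most [eps (w + h)], and the perimeter is
    [2 (w + h)]. Bisection therefore gives it for the original rectangle and every [eps]. *)
Lemma goursat (F : C -> C) (a b c d : R) : a <= b -> c <= d ->
  holo_rect F a b c d -> rect_int F a b c d = 0%C.
Proof.
  intros Hab Hcd HF. apply Cmod_eq_0.
  set (w := b - a). set (h := d - c).
  assert (Hw : 0 <= w) by (unfold w; lra). assert (Hh : 0 <= h) by (unfold h; lra).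
  assert (key : forall eps, 0 < eps -> Cmod (rect_int F a b c d) <= eps * (2 * (w + h) * (w + h))).
  { intros eps He.
    set (P := fun n x y => Cmod (rect_int F x (x + w / 2 ^ n) y (y + h / 2 ^ n))
       <= eps * (2 * (w / 2 ^ n + h / 2 ^ n) * (w / 2 ^ n + h / 2 ^ n))).
    assert (HP : P 0%nat a c).
    { apply (rect_bisection a c w h P Hw Hh).
      - intros n x y X1 X2 Y1 Y2 P1 P2 P3 P4. unfold P in *.
        assert (Hw' := half_pow w n). assert (Hh' := half_pow h n).
        assert (0 <= w / 2 ^ S n) by now apply div_pow2_nonneg.
        assert (0 <= h / 2 ^ S n) by now apply div_pow2_nonneg.
        rewrite Hw', Hh' in *.
        set (w' := w / 2 ^ S n) in *. set (h' := h / 2 ^ S n) in *.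
        assert (HF' : forall x1 x2 y1 y2, x <= x1 -> x2 <= x + (w' + w') ->
          y <= y1 -> y2 <= y + (h' + h') -> holo_rect F x1 x2 y1 y2).
        { intros x1 x2 y1 y2 ? ? ? ? s t Hs Ht. apply HF; unfold w, h in *; lra. }
        rewrite (rect_int_split_x F x (x + w') (x + (w' + w'))) by (apply HF' || idtac; lra).
        rewrite (rect_int_split_y F x (x + w') y (y + h') (y + (h' + h')))
          by (apply HF' || idtac; lra).
        rewrite (rect_int_split_y F (x + w') (x + (w' + w')) y (y + h') (y + (h' + h')))
          by (apply HF' || idtac; lra).
        rewrite Rplus_assoc in P2, P4. rewrite Rplus_assoc in P3.
        rewrite (Rplus_assoc y h' h') in P4.
        eapply Rle_trans; [apply Cmod_triangle|].
        eapply Rle_trans; [apply Rplus_le_compat; apply Cmod_triangle|].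
        nra.
      - intros u v Hu Hv.
        destruct (HF u v) as [l Hl]; [unfold w in *; lra|unfold h in *; lra|].
        rewrite is_Cderive_eps in Hl. destruct (Hl eps He) as [del [Hd1 Hd2]].
        destruct (pow2_small (w + h) del Hd1) as [N HN].
        exists N. intros n x y Hn X1 X2 Y1 Y2 Xu Yv. specialize (HN n Hn).
        unfold P.
        assert (Hw' : 0 <= w / 2 ^ n) by now apply div_pow2_nonneg.
        assert (Hh' : 0 <= h / 2 ^ n) by now apply div_pow2_nonneg.
        assert (E : (w + h) / 2 ^ n = w / 2 ^ n + h / 2 ^ n)
          by (field; apply pow_nonzero; lra).
        rewrite E in HN.
        set (w' := w / 2 ^ n) in *. set (h' := h / 2 ^ n) in *.
        set (p := (u + v * Ci)%C) in *.
        replace (eps * (2 * (w' + h') * (w' + h')))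
          with (2 * ((x + w' - x) + (y + h' - y)) * (eps * (w' + h'))) by ring.
        apply rect_int_affine_error with (u := (F p - l * p)%C) (v := l); [lra|lra| |].
        + intros s t Hs Ht. apply HF; unfold w, h in *; lra.
        + intros s t Hs Ht.
          assert (Hz : Cmod (s + t * Ci - p)%C <= w' + h').
          { eapply Rle_trans; [apply Cmod_re_im_le|].
            replace (Re (s + t * Ci - p)%C) with (s - u) by (unfold p; simpl; ring).
            replace (Im (s + t * Ci - p)%C) with (t - v) by (unfold p; simpl; ring).
            apply Rplus_le_compat; apply Rabs_le; lra. }
          specialize (Hd2 (s + t * Ci)%C ltac:(lra)).
          replace (F (s + t * Ci) - (F p - l * p + l * (s + t * Ci)))%C
            with (F (s + t * Ci) - F p - l * (s + t * Ci - p))%C by ring.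
          eapply Rle_trans; [exact Hd2|]. apply Rmult_le_compat_l; lra. }
    unfold P in HP. simpl in HP. rewrite !Rdiv_1_r in HP.
    replace (a + w) with b in HP by (unfold w; ring).
    replace (c + h) with d in HP by (unfold h; ring). exact HP. }
  apply Rle_antisym; [|apply Cmod_ge_0].
  apply le_epsilon. intros eps He.
  set (K := 2 * (w + h) * (w + h)) in *.
  assert (0 <= K) by (unfold K; nra).
  specialize (key (eps / (K + 1)) ltac:(apply Rdiv_lt_0_compat; lra)).
  eapply Rle_trans; [exact key|]. rewrite Rplus_0_l.
  apply Rmult_le_reg_r with (K + 1); [lra|].
  replace (eps / (K + 1) * K * (K + 1)) with (eps * K) by (field; lra). nra.
Qed.

(** * The maximum principle *)

Definition cexp (z : C) : C := (exp (Re z) * cos (Im z), exp (Re z) * sin (Im z)).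

Lemma cexp_plus (z w : C) : cexp (z + w)%C = (cexp z * cexp w)%C.
Proof.
  unfold cexp, Cmult. rewrite re_plus, im_plus, exp_plus, cos_plus, sin_plus. simpl.
  f_equal; ring.
Qed.

Lemma Cmod_cexp (z : C) : Cmod (cexp z) = exp (Re z).
Proof.
  apply Rsqr_inj; [apply Cmod_ge_0|apply Rlt_le, exp_pos|].
  rewrite !Rsqr_pow2, Cmod2_alt. unfold cexp. simpl.
  generalize (sin2_cos2 (Im z)). unfold Rsqr. intros E.
  transitivity (exp (Re z) * exp (Re z) * (sin (Im z) * sin (Im z) + cos (Im z) * cos (Im z)));
    [ring|rewrite E; ring].
Qed.

Lemma derivable_pt_lim_error (f : R -> R) (l : R) : derivable_pt_lim f 0 l ->
  forall eps, 0 < eps -> exists d, 0 < d /\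
    forall h, Rabs h < d -> Rabs (f h - f 0 - l * h) <= eps * Rabs h.
Proof.
  intros H eps He. destruct (H eps He) as [d Hd]. exists d. split; [apply cond_pos|].
  intros h Hh. destruct (Req_dec h 0) as [->|Hh0].
  { replace (f 0 - f 0 - l * 0) with 0 by ring. rewrite Rabs_R0. lra. }
  specialize (Hd h Hh0 Hh). rewrite Rplus_0_l in Hd.
  replace (f h - f 0 - l * h) with (((f h - f 0) / h - l) * h) by (field; assumption).
  rewrite Rabs_mult. apply Rmult_le_compat_r; [apply Rabs_pos|lra].
Qed.

Lemma is_Cderive_cexp_0 : is_Cderive cexp (RtoC 0) (RtoC 1).
Proof.
  apply is_Cderive_eps. intros eps He.
  (* The real and imaginary parts of the error are each at most [3 e |w|], since [exp x <= 2] and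
     [|exp x - 1| <= e]; the latter comes from the bound [e / 2] on [|w|] below. *)
  set (e := Rmin 1 (eps / 12)).
  assert (He1 : 0 < e) by (apply Rmin_pos; lra).
  assert (He2 : e <= 1) by apply Rmin_l.
  assert (He3 : e <= eps / 12) by apply Rmin_r.
  destruct (derivable_pt_lim_error exp 1) with (eps := e) as [d1 [D1 H1]];
    [rewrite <- exp_0; apply derivable_pt_lim_exp|assumption|].
  destruct (derivable_pt_lim_error sin 1) with (eps := e) as [d2 [D2 H2]];
    [rewrite <- cos_0; apply derivable_pt_lim_sin|assumption|].
  destruct (derivable_pt_lim_error cos 0) with (eps := e) as [d3 [D3 H3]];
    [replace 0 with (- sin 0) at 2 by (rewrite sin_0; ring); apply derivable_pt_lim_cos
    |assumption|].
  exists (Rmin (e / 2) (Rmin d1 (Rmin d2 d3))). split.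
  { repeat apply Rmin_pos; lra. }
  intros w Hw. replace (w - 0)%C with w in * by ring.
  apply Rmin_Rgt_l in Hw as [W0 Hw]. apply Rmin_Rgt_l in Hw as [W1 Hw].
  apply Rmin_Rgt_l in Hw as [W2 W3].
  assert (Hx : Rabs (Re w) <= Cmod w) by apply re_le_Cmod.
  assert (Hy : Rabs (Im w) <= Cmod w).
  { eapply Rle_trans; [apply Rmax_r|apply Rmax_Cmod]. }
  specialize (H1 (Re w) ltac:(lra)). specialize (H2 (Im w) ltac:(lra)).
  specialize (H3 (Im w) ltac:(lra)).
  rewrite exp_0 in H1. rewrite sin_0 in H2. rewrite cos_0 in H3.
  eapply Rle_trans; [apply Cmod_re_im_le|].
  replace (Re (cexp w - cexp 0 - 1 * w)%C)
    with ((exp (Re w) - 1 - 1 * Re w) + exp (Re w) * (cos (Im w) - 1 - 0 * Im w)).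
  2:{ unfold cexp, Re, Im. simpl. rewrite exp_0, cos_0. ring. }
  replace (Im (cexp w - cexp 0 - 1 * w)%C)
    with ((exp (Re w) - 1) * Im w + exp (Re w) * (sin (Im w) - 0 - 1 * Im w)).
  2:{ unfold cexp, Re, Im. simpl. rewrite exp_0, sin_0. ring. }
  set (x := Re w) in *. set (y := Im w) in *. set (m := Cmod w) in *.
  assert (HE : Rabs (exp x - 1) <= e).
  { replace (exp x - 1) with ((exp x - 1 - 1 * x) + x) by ring.
    eapply Rle_trans; [apply Rabs_triang|]. nra. }
  assert (HE2 : Rabs (exp x) <= 2).
  { replace (exp x) with ((exp x - 1) + 1) by ring.
    eapply Rle_trans; [apply Rabs_triang|]. rewrite Rabs_R1. lra. }
  assert (0 <= Rabs x) by apply Rabs_pos. assert (0 <= Rabs y) by apply Rabs_pos.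
  assert (0 <= Rabs (exp x)) by apply Rabs_pos.
  assert (0 <= Rabs (exp x - 1)) by apply Rabs_pos.
  assert (0 <= Rabs (cos y - 1 - 0 * y)) by apply Rabs_pos.
  assert (0 <= Rabs (sin y - 0 - 1 * y)) by apply Rabs_pos.
  assert (T1 : Rabs (exp x - 1 - 1 * x + exp x * (cos y - 1 - 0 * y)) <= 3 * (e * m)).
  { eapply Rle_trans; [apply Rabs_triang|]. rewrite Rabs_mult. nra. }
  assert (T2 : Rabs ((exp x - 1) * y + exp x * (sin y - 0 - 1 * y)) <= 3 * (e * m)).
  { eapply Rle_trans; [apply Rabs_triang|]. rewrite !Rabs_mult. nra. }
  nra.
Qed.

Lemma is_Cderive_cexp (z : C) : is_Cderive cexp z (cexp z).
Proof.
  assert (H : is_Cderive (fun w => cexp z * cexp (w - z))%C z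
     (0 * cexp (z - z) + cexp z * (1 * (1 - 0)))%C).
  { apply (is_Cderive_mult (fun _ => cexp z) (fun w => cexp (w - z)%C)).
    - apply is_Cderive_const.
    - apply (is_Cderive_comp cexp (fun w => w - z)%C).
      + replace (z - z)%C with (RtoC 0) by ring. apply is_Cderive_cexp_0.
      + apply (is_Cderive_minus (fun w => w) (fun _ => z));
          [apply is_Cderive_id|apply is_Cderive_const]. }
  replace (0 * cexp (z - z) + cexp z * (1 * (1 - 0)))%C with (cexp z) in H by ring.
  apply (is_Cderive_ext_loc (fun w => cexp z * cexp (w - z))%C _ _ _ 1 Rlt_0_1); [|exact H].
  intros w _. rewrite <- cexp_plus. f_equal. ring.
Qed.

Lemma Ci_mult_sub_eq_0 (a b : C) : (Ci * (a - b))%C = 0%C -> a = b.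
Proof.
  intros E. assert (HC : (Ci * Ci)%C = (- (1))%C) by (apply injective_projections; simpl; ring).
  replace a with (b - Ci * Ci * (a - b))%C by (rewrite HC; ring).
  rewrite <- Cmult_assoc, E. ring.
Qed.

(* Goursat's theorem for [f o cexp] on [[s0, ln r] x [0, 2 pi]]: by periodicity
   the horizontal sides cancel, and [s0 -> -oo] yields the mean value property. *)
Lemma mean_value_bound (f : C -> C) (r M : R) : holomorphic_disk f -> 0 < r < 1 ->
  (forall z, Cmod z = r -> Cmod (f z) <= M) -> Cmod (f 0%C) <= M.
Proof.
  intros Hf Hr HM. apply le_epsilon. intros eps He.
  destruct (Hf 0%C) as [l Hl]; [unfold disk; rewrite Cmod_0; lra|].
  destruct (is_Cderive_continuous f _ l Hl eps He) as [d [Hd1 Hd2]].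
  set (F := fun z => f (cexp z)).
  (* The right side of the rectangle is mapped to the circle of radius [r], the left side to one of
     radius at most [d / 2], on which [f] is within [eps] of [f 0]. *)
  set (s1 := ln r). set (s0 := Rmin s1 (ln (d / 2))).
  assert (Hs : s0 <= s1) by apply Rmin_l.
  assert (Hs0 : exp s0 < d).
  { apply Rle_lt_trans with (exp (ln (d / 2))).
    - destruct (Rle_lt_or_eq_dec _ _ (Rmin_r s1 (ln (d / 2)))) as [H|H].
      + left. now apply exp_increasing.
      + unfold s0. rewrite H. lra.
    - rewrite exp_ln; lra. }
  assert (Hs1 : exp s1 = r) by (apply exp_ln; lra).
  assert (Hp : 0 <= 2 * PI) by (generalize PI_RGT_0; lra).
  assert (HF : holo_rect F s0 s1 0 (2 * PI)).
  { intros x y Hx Hy.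
    destruct (Hf (cexp (x + y * Ci)%C)) as [l' Hl'].
    - unfold disk. rewrite Cmod_cexp.
      replace (Re (x + y * Ci)%C) with x by (simpl; ring).
      apply Rle_lt_trans with r; [|lra]. rewrite <- Hs1.
      destruct (Rle_lt_or_eq_dec _ _ (proj2 Hx)) as [H|H]; [left; now apply exp_increasing|].
      rewrite H. lra.
    - eexists. apply (is_Cderive_comp f cexp); [exact Hl'|apply is_Cderive_cexp]. }
  assert (E := goursat F s0 s1 0 (2 * PI) Hs Hp HF). unfold rect_int in E.
  rewrite (RInt_ext (V := C_R_CompleteNormedModule)
    (fun x : R => F (Ci * (2 * PI)%R + x * 1)%C) (fun x : R => F (Ci * 0%R + x * 1)%C)) in E.
  2:{ intros x _. unfold F. f_equal. unfold cexp. simpl.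
      rewrite !Rmult_0_l, !Rmult_0_r, !Rmult_1_r, !Rmult_1_l, !Rplus_0_l, !Rminus_0_r, !Rplus_0_r.
      rewrite cos_2PI, sin_2PI, cos_0, sin_0. reflexivity. }
  set (I0 := RIntC (fun y : R => F (s0 + y * Ci)%C) 0 (2 * PI)) in *.
  set (I1 := RIntC (fun y : R => F (s1 + y * Ci)%C) 0 (2 * PI)) in *.
  assert (E01 : I1 = I0 :> C).
  { apply Ci_mult_sub_eq_0. etransitivity; [|exact E]. ring. }
  assert (Hex : forall x, s0 <= x <= s1 -> ex_RIntC (fun y : R => F (x + y * Ci)%C) 0 (2 * PI)).
  { intros x Hx. apply (holo_rect_vertical F s0 s1 0 (2 * PI)); lra || assumption. }
  assert (B1 : Cmod I1 <= (2 * PI - 0) * M).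
  { apply RInt_line_bound; [assumption|apply Hex; lra|].
    intros t Ht. apply HM. rewrite Cmod_cexp, <- Hs1. f_equal. simpl. ring. }
  assert (B0 : Cmod (I0 - ((2 * PI - 0)%R * (f 0 + 0 * s0)
        + (((2 * PI) ^ 2 - 0 ^ 2) / 2)%R * (0 * Ci)))%C <= (2 * PI - 0) * eps).
  { apply RInt_line_affine_error; [assumption|apply Hex; lra|].
    intros t Ht. left.
    replace (f 0 + 0 * (s0 + t * Ci))%C with (f 0%C) by ring.
    apply Hd2. replace (cexp (s0 + t * Ci) - 0)%C with (cexp (s0 + t * Ci)) by ring.
    rewrite Cmod_cexp. replace (Re (s0 + t * Ci)%C) with s0 by (simpl; ring). exact Hs0. }
  replace ((2 * PI - 0)%R * (f 0 + 0 * s0) + (((2 * PI) ^ 2 - 0 ^ 2) / 2)%R * (0 * Ci))%C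
    with ((2 * PI)%R * f 0)%C in B0 by (rewrite Rminus_0_r; ring).
  rewrite Rminus_0_r in *. rewrite E01 in B1.
  assert (B2 : Cmod ((2 * PI)%R * f 0)%C <= 2 * PI * (M + eps)).
  { replace ((2 * PI)%R * f 0)%C with (I0 - (I0 - (2 * PI)%R * f 0))%C by ring.
    eapply Rle_trans; [apply Cmod_sub_le|]. lra. }
  rewrite Cmod_mult, Cmod_R, Rabs_right in B2 by lra.
  apply Rmult_le_reg_l in B2; [assumption|]. generalize PI_RGT_0; lra.
Qed.

(** * Automorphisms of the disk, which carry the mean value property to every point *)

Lemma disk_denom_neq_0 (a z : C) : disk a -> Cmod z <= 1 -> (1 - Cconj a * z)%C <> 0%C.
Proof.
  unfold disk. intros Ha Hz. apply Cmod_neq_0.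
  eapply Rlt_le_trans; [|apply Cmod_triangle_sub].
  rewrite Cmod_1, Cmod_mult, Cmod_conj.
  assert (0 <= Cmod a) by apply Cmod_ge_0. assert (0 <= Cmod z) by apply Cmod_ge_0. nra.
Qed.

Lemma Cmod2_denom_sub (a z : C) :
  Cmod (1 - Cconj a * z)%C ^ 2 - Cmod (z - a)%C ^ 2 = (1 - Cmod a ^ 2) * (1 - Cmod z ^ 2).
Proof. rewrite !Cmod2_alt. destruct a, z. simpl. ring. Qed.

(** Stated for every [z] off the pole, because the sign of [1 - |z|^2] is also read outside the
    disk. *)
Lemma Cmod2_blaschke_factor_gen (a z : C) : (1 - Cconj a * z)%C <> 0%C ->
  1 - Cmod (blaschke_factor a z) ^ 2
  = (1 - Cmod a ^ 2) * (1 - Cmod z ^ 2) / Cmod (1 - Cconj a * z)%C ^ 2.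
Proof.
  intros H0. rewrite <- Cmod2_denom_sub. unfold blaschke_factor.
  rewrite Cmod_div by assumption. field. now apply Rgt_not_eq, Cmod_gt_0.
Qed.

Lemma Cmod2_blaschke_factor (a z : C) : disk a -> Cmod z <= 1 ->
  1 - Cmod (blaschke_factor a z) ^ 2
  = (1 - Cmod a ^ 2) * (1 - Cmod z ^ 2) / Cmod (1 - Cconj a * z)%C ^ 2.
Proof. intros Ha Hz. now apply Cmod2_blaschke_factor_gen, disk_denom_neq_0. Qed.

Lemma Cmod_sq_lt (z : C) : disk z -> 0 < 1 - Cmod z ^ 2.
Proof. unfold disk. intros H. assert (0 <= Cmod z) by apply Cmod_ge_0. nra. Qed.

Lemma disk_blaschke_factor (a z : C) : disk a -> disk z -> disk (blaschke_factor a z).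
Proof.
  intros Ha Hz. assert (Hz' : Cmod z <= 1) by (unfold disk in Hz; lra).
  assert (H := Cmod2_blaschke_factor a z Ha Hz').
  assert (0 < 1 - Cmod (blaschke_factor a z) ^ 2).
  { rewrite H. apply Rdiv_lt_0_compat.
    - apply Rmult_lt_0_compat; now apply Cmod_sq_lt.
    - apply pow_lt, Cmod_gt_0. now apply disk_denom_neq_0. }
  unfold disk. assert (0 <= Cmod (blaschke_factor a z)) by apply Cmod_ge_0. nra.
Qed.

Lemma is_Cderive_blaschke_factor (a z : C) : (1 - Cconj a * z)%C <> 0%C ->
  is_Cderive (blaschke_factor a) z
    ((1 - a * Cconj a) / ((1 - Cconj a * z) * (1 - Cconj a * z)))%C.
Proof.
  intros H0. unfold blaschke_factor.
  replace (1 - a * Cconj a)%C with ((1 - 0) * (1 - Cconj a * z)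
    - (z - a) * (0 - (0 * z + Cconj a * 1)))%C by ring.
  apply (is_Cderive_div (fun w => w - a)%C (fun w => 1 - Cconj a * w)%C); [| |assumption].
  - apply (is_Cderive_minus (fun w => w) (fun _ => a));
      [apply is_Cderive_id|apply is_Cderive_const].
  - apply (is_Cderive_minus (fun _ => RtoC 1) (fun w => Cconj a * w)%C);
      [apply is_Cderive_const|].
    apply (is_Cderive_mult (fun _ => Cconj a) (fun w => w));
      [apply is_Cderive_const|apply is_Cderive_id].
Qed.

Lemma disk_opp (a : C) : disk a -> disk (- a)%C.
Proof. unfold disk. now rewrite Cmod_opp. Qed.

Lemma holomorphic_blaschke_factor (a : C) : disk a -> holomorphic_disk (blaschke_factor a).
Proof.
  intros Ha z Hz. eexists. apply is_Cderive_blaschke_factor, disk_denom_neq_0;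
    [assumption|unfold disk in Hz; lra].
Qed.

Lemma holomorphic_comp (f g : C -> C) : holomorphic_disk f -> holomorphic_disk g ->
  (forall z, disk z -> disk (g z)) -> holomorphic_disk (fun z => f (g z)).
Proof.
  intros Hf Hg Hm z Hz. destruct (Hg z Hz) as [b Hb]. destruct (Hf (g z) (Hm z Hz)) as [a Hl].
  eexists. apply (is_Cderive_comp f g); eassumption.
Qed.

(** The automorphism [blaschke_factor (- a)] sends 0 to [a] and a circle of radius close to 1 into
    the collar [|z| >= rho], where the bound is known. The mean value bound for the composition then
    gives it at [a]. A collar takes the place of boundary values, which [f] need not have. *)
Lemma max_principle (f : C -> C) (rho M : R) : holomorphic_disk f -> rho < 1 ->
  (forall z, disk z -> rho <= Cmod z -> Cmod (f z) <= M) ->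
  forall a, disk a -> Cmod (f a) <= M.
Proof.
  intros Hf Hrho HM a Ha.
  assert (Ha' := disk_opp a Ha).
  assert (Ha0 : 0 <= Cmod a) by apply Cmod_ge_0.
  unfold disk in Ha.
  set (rho' := Rmax rho 0).
  assert (R0 : 0 <= rho' < 1) by (split; [apply Rmax_r|apply Rmax_lub_lt; lra]).
  (* With [T] the automorphism, [1 - |T z|^2 = (1 - |a|^2) (1 - r^2) / D^2] on [|z| = r], and
     [D >= 1 - |a|]. The radius [r] below makes the right-hand side at most [k], and
     [k <= 1 - rho'^2] puts [T z] in the collar. *)
  set (k := (1 - rho' ^ 2) * (1 - Cmod a) / 2).
  assert (Hk : 0 < k <= / 2).
  { unfold k. assert (0 < 1 - rho' ^ 2 <= 1) by nra. set (m := 1 - rho' ^ 2) in *. nra. }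
  set (r := sqrt (1 - k * (1 - Cmod a) / (1 + Cmod a))).
  assert (Hq : 0 < k * (1 - Cmod a) / (1 + Cmod a) < 1).
  { split; [apply Rdiv_lt_0_compat; nra|]. apply (Rdiv_lt_1 (k * (1 - Cmod a))); nra. }
  assert (Hr : 0 < r < 1).
  { unfold r. split; [apply sqrt_lt_R0; lra|].
    apply Rlt_le_trans with (sqrt 1); [apply sqrt_lt_1; lra|rewrite sqrt_1; lra]. }
  replace (f a) with (f (blaschke_factor (- a) 0)).
  2:{ f_equal. unfold blaschke_factor. rewrite Cmult_0_r. field. }
  apply (mean_value_bound (fun z => f (blaschke_factor (- a) z)) r M).
  - apply holomorphic_comp; [assumption|now apply holomorphic_blaschke_factor|].
    intros z Hz. now apply disk_blaschke_factor.
  - assumption.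
  - intros z Hz.
    assert (Hz1 : disk z) by (unfold disk; lra).
    assert (HT := disk_blaschke_factor (- a) z Ha' Hz1).
    apply HM; [assumption|].
    assert (E := Cmod2_blaschke_factor (- a) z Ha' ltac:(lra)).
    set (t := Cmod (blaschke_factor (- a) z)) in *. fold t.
    assert (Ht : 0 <= t) by apply Cmod_ge_0.
    rewrite Cmod_opp, Hz in E.
    assert (Hr2 : 1 - r ^ 2 = k * (1 - Cmod a) / (1 + Cmod a)).
    { unfold r. rewrite pow2_sqrt by lra. ring. }
    rewrite Hr2 in E.
    assert (HD : 1 - Cmod a <= Cmod (1 - Cconj (- a) * z)%C).
    { eapply Rle_trans; [|apply Cmod_triangle_sub].
      rewrite Cmod_1, Cmod_mult, Cmod_conj, Cmod_opp, Hz. nra. }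
    set (D := Cmod (1 - Cconj (- a) * z)%C) in *.
    assert (HD2 : (1 - Cmod a) ^ 2 <= D ^ 2) by nra.
    assert (Hle : 1 - t ^ 2 <= k).
    { rewrite E. apply Rmult_le_reg_r with (D ^ 2); [nra|].
      replace ((1 - Cmod a ^ 2) * (k * (1 - Cmod a) / (1 + Cmod a)) / D ^ 2 * D ^ 2)
        with (k * (1 - Cmod a) ^ 2) by (field; split; nra). nra. }
    assert (Hk2 : k <= 1 - rho' ^ 2).
    { unfold k. assert (0 < 1 - rho' ^ 2) by nra. nra. }
    apply Rle_trans with rho'; [apply Rmax_l|]. nra.
Qed.

(** * Schwarz's lemma, the identity principle and Harnack's inequality *)

Lemma pow_bounded_le_1 (x K : R) : 0 <= x -> (forall n, x ^ n <= K) -> x <= 1.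
Proof.
  intros Hx H. apply Rnot_lt_le. intros H1.
  destruct (Pow_x_infinity x ltac:(rewrite Rabs_right; lra) (K + 1)) as [N HN].
  specialize (HN N (Nat.le_refl N)). specialize (H N).
  rewrite Rabs_right in HN by (apply Rle_ge, pow_le; assumption). lra.
Qed.

Lemma pow_domination (x M t : R) : 0 <= t < 1 -> 0 <= M ->
  (forall n, x <= M * t ^ n) -> x <= 0.
Proof.
  intros Ht HM H. apply le_epsilon. intros eps He. rewrite Rplus_0_l.
  destruct (pow_lt_1_zero t ltac:(rewrite Rabs_right; lra) (eps / (M + 1))) as [N HN].
  { apply Rdiv_lt_0_compat; lra. }
  specialize (HN N (Nat.le_refl N)). specialize (H N).
  rewrite Rabs_right in HN by (apply Rle_ge, pow_le; lra).
  apply Rmult_lt_compat_r with (r := M + 1) in HN; [|lra].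
  unfold Rdiv in HN. rewrite Rmult_assoc, Rinv_l, Rmult_1_r in HN by lra.
  assert (0 <= t ^ N) by (apply pow_le; lra). nra.
Qed.

(* Replaces the removable singularity theorem: [(g w / w) ^ n] need not be
   differentiable at [0], but multiplied by [w] it is, and the extra factor
   disappears after taking [n]-th roots. *)
Lemma is_Cderive_mult_quotient_pow (g : C -> C) (l : C) (n : nat) :
  is_Cderive g (RtoC 0) l -> g 0%C = 0%C ->
  is_Cderive (fun w => w * (g w / w) ^ n)%C (RtoC 0) (l ^ n)%C.
Proof.
  intros Hg G0. apply is_Cderive_eps. intros eps He.
  destruct (is_Cderive_pow (fun w => w) l 1%C n (is_Cderive_id l)) as [l' Hl'].
  destruct (is_Cderive_continuous _ _ _ Hl' eps He) as [d [D1 D2]].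
  rewrite is_Cderive_eps in Hg. destruct (Hg (d / 2) ltac:(lra)) as [d' [D3 D4]].
  exists d'. split; [assumption|]. intros w Hw. specialize (D4 w Hw). rewrite G0 in D4.
  replace (w - 0)%C with w in * by ring.
  destruct (Ceq_dec w 0) as [->|Hw0].
  { replace (0 * (g 0 / 0) ^ n - 0 * (g 0 / 0) ^ n - l ^ n * 0)%C with (RtoC 0) by ring.
    rewrite Cmod_0. lra. }
  replace (w * (g w / w) ^ n - 0 * (g 0 / 0) ^ n - l ^ n * w)%C
    with (((g w / w) ^ n - l ^ n) * w)%C by ring.
  rewrite Cmod_mult. apply Rmult_le_compat_r; [apply Cmod_ge_0|].
  left. apply D2.
  replace (g w / w - l)%C with ((g w - 0 - l * w) / w)%C by (field; assumption).
  rewrite Cmod_div by assumption. apply Cmod_gt_0 in Hw0.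
  apply Rle_lt_trans with (d / 2); [|lra].
  apply Rmult_le_reg_r with (Cmod w); [assumption|].
  unfold Rdiv at 1. rewrite Rmult_assoc, Rinv_l, Rmult_1_r by lra. exact D4.
Qed.

(** The maximum principle for [w (g w / w)^n] on [|w| >= rho] gives [|z| (rho |g z / z|)^n <= 1] for
    all [n], hence [rho |g z / z| <= 1]; then [rho] tends to 1. The values of [g] may reach the
    circle, as happens below when an imaginary part vanishes. *)
Lemma schwarz (g : C -> C) : holomorphic_disk g ->
  (forall z, disk z -> Cmod (g z) <= 1) -> g 0%C = 0%C ->
  forall z, disk z -> Cmod (g z) <= Cmod z.
Proof.
  intros Hg Hb G0 z Hz.
  destruct (Ceq_dec z 0) as [->|Hz0]; [rewrite G0; lra|].
  apply Cmod_gt_0 in Hz0 as Hzp. unfold disk in Hz.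
  assert (key : forall rho, Cmod z < rho < 1 -> rho * Cmod (g z / z)%C <= 1).
  { intros rho Hrho.
    apply pow_bounded_le_1 with (/ Cmod z).
    { apply Rmult_le_pos; [lra|apply Cmod_ge_0]. }
    intros n.
    assert (H : Cmod (z * (g z / z) ^ n)%C <= (/ rho) ^ n).
    { apply (max_principle (fun w => w * (g w / w) ^ n)%C rho); [|lra| |exact Hz].
      - intros w Hw. destruct (Hg w Hw) as [l Hl].
        destruct (Ceq_dec w 0) as [->|Hw0].
        + eexists. exact (is_Cderive_mult_quotient_pow g l n Hl G0).
        + destruct (is_Cderive_pow (fun w => g w / w)%C w _ n
            (is_Cderive_div g (fun w => w) w _ _ Hl (is_Cderive_id w) Hw0)) as [l' Hl'].
          eexists. apply (is_Cderive_mult (fun w => w)); [apply is_Cderive_id|exact Hl'].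
      - intros w Hw Hr. assert (Hw0 : w <> 0%C) by (apply Cmod_neq_0; lra).
        specialize (Hb w Hw). unfold disk in Hw.
        rewrite Cmod_mult, Cmod_pow, Cmod_div by assumption.
        assert (Hq : 0 <= Cmod (g w) / Cmod w <= / rho).
        { split.
          - apply Rmult_le_pos; [apply Cmod_ge_0|]. apply Rlt_le, Rinv_0_lt_compat. lra.
          - unfold Rdiv. rewrite <- (Rmult_1_l (/ rho)).
            apply Rmult_le_compat; [apply Cmod_ge_0| |assumption|].
            + apply Rlt_le, Rinv_0_lt_compat. lra.
            + apply Rinv_le_contravar; lra. }
        rewrite <- (Rmult_1_l ((/ rho) ^ n)).
        apply Rmult_le_compat; [apply Cmod_ge_0|apply pow_le; lra|lra|].
        now apply pow_incr. }
    rewrite Cmod_mult, Cmod_pow in H. rewrite Rpow_mult_distr.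
    rewrite pow_inv in H.
    assert (Hp : 0 < rho ^ n) by (apply pow_lt; lra).
    apply Rmult_le_reg_l with (Cmod z); [assumption|]. rewrite Rinv_r by lra.
    apply Rmult_le_compat_l with (r := rho ^ n) in H; [|lra].
    rewrite Rinv_r in H by lra. lra. }
  assert (Hq : Cmod (g z / z)%C <= 1).
  { apply le_epsilon. intros eps He. set (q := Cmod (g z / z)%C) in *.
    assert (Hq0 : 0 <= q) by apply Cmod_ge_0.
    (* The first entry puts [rho] above [|z|], the second turns [rho q <= 1] into [q <= 1 + eps]. *)
    set (rho := Rmax ((1 + Cmod z) / 2) (/ (1 + eps))).
    assert (Hi : / (1 + eps) < 1) by (rewrite <- Rinv_1; apply Rinv_lt_contravar; lra).
    assert (H1 : (1 + Cmod z) / 2 <= rho) by apply Rmax_l.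
    assert (H2 : / (1 + eps) <= rho) by apply Rmax_r.
    assert (H3 : rho < 1) by (apply Rmax_lub_lt; lra).
    specialize (key rho ltac:(lra)).
    assert (H4 : / (1 + eps) * q <= 1) by nra.
    apply Rmult_le_compat_l with (r := 1 + eps) in H4; [|lra].
    rewrite <- Rmult_assoc, Rinv_r in H4 by lra. lra. }
  rewrite Cmod_div in Hq by assumption.
  apply Rmult_le_compat_r with (r := Cmod z) in Hq; [|lra].
  unfold Rdiv in Hq. rewrite Rmult_assoc, Rinv_l in Hq by lra. lra.
Qed.

(** Division by [w^n] preserves holomorphy, as the quotient is 0 near 0, whatever the inverse of 0
    is. The maximum principle gives [|g z| <= M (|z| / rho)^n] with [|z| < rho], and [n] is
    arbitrary. *)
Lemma zero_near_0_zero (g : C -> C) (r M : R) : holomorphic_disk g -> 0 < r ->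
  (forall z, disk z -> Cmod (g z) <= M) -> (forall z, Cmod z < r -> g z = 0%C) ->
  forall z, disk z -> g z = 0%C.
Proof.
  intros Hg Hr HM H0 z Hz.
  destruct (Ceq_dec z 0) as [->|Hz0]; [apply H0; rewrite Cmod_0; exact Hr|].
  apply Cmod_gt_0 in Hz0 as Hzp. unfold disk in Hz.
  apply Cmod_eq_0, Rle_antisym; [|apply Cmod_ge_0].
  set (rho := (1 + Cmod z) / 2). assert (Hrho : Cmod z < rho < 1) by (unfold rho; lra).
  assert (HM0 : 0 <= M) by (eapply Rle_trans; [apply Cmod_ge_0|apply (HM z Hz)]).
  apply pow_domination with M (Cmod z / rho); [|assumption|].
  { split; [apply Rmult_le_pos; [lra|apply Rlt_le, Rinv_0_lt_compat; lra]|].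
    apply (Rdiv_lt_1 (Cmod z)); lra. }
  intros n.
  assert (H : Cmod (g z / z ^ n)%C <= M * / rho ^ n).
  { apply (max_principle (fun w => g w / w ^ n)%C rho); [|lra| |exact Hz].
    - intros w Hw. destruct (Ceq_dec w 0) as [->|Hw0].
      + exists (RtoC 0). apply (is_Cderive_ext_loc (fun _ => 0%C) _ _ _ r Hr); [|apply is_Cderive_const].
        intros w Hwr. replace (w - 0)%C with w in Hwr by ring. rewrite (H0 w Hwr).
        unfold Cdiv. ring.
      + destruct (Hg w Hw) as [l Hl].
        destruct (is_Cderive_pow (fun w => w) w _ n (is_Cderive_id w)) as [l' Hl'].
        eexists. apply (is_Cderive_div g (fun w => w ^ n)%C); [exact Hl|exact Hl'|].
        now apply Cpow_nz.
    - intros w Hw Hrw. assert (Hw0 : w <> 0%C) by (apply Cmod_neq_0; lra).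
      rewrite Cmod_div, Cmod_pow by now apply Cpow_nz.
      assert (0 < rho ^ n) by (apply pow_lt; lra).
      apply Rmult_le_compat; [apply Cmod_ge_0| |now apply HM|].
      + apply Rlt_le, Rinv_0_lt_compat, pow_lt. lra.
      + apply Rinv_le_contravar; [assumption|]. apply pow_incr. lra. }
  rewrite Cmod_div, Cmod_pow in H by now apply Cpow_nz.
  assert (Hzn : 0 < Cmod z ^ n) by now apply pow_lt.
  apply Rmult_le_compat_r with (r := Cmod z ^ n) in H; [|lra].
  unfold Rdiv in H. rewrite Rmult_assoc, Rinv_l, Rmult_1_r in H by lra.
  unfold Rdiv. rewrite Rpow_mult_distr, pow_inv. lra.
Qed.

Lemma blaschke_factor_opp (a z : C) : disk a -> disk z ->
  blaschke_factor (- a) (blaschke_factor a z) = z.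
Proof.
  intros Ha Hz. unfold blaschke_factor. rewrite Copp_conj.
  assert (H1 : (1 - Cconj a * z)%C <> 0%C)
    by (apply disk_denom_neq_0; [assumption|unfold disk in Hz; lra]).
  assert (H2 : (1 - Cconj a * a)%C <> 0%C)
    by (apply disk_denom_neq_0; [assumption|unfold disk in Ha; lra]).
  field. split; [exact H1|].
  intros E. apply H2. rewrite <- E. ring.
Qed.

(** A disk automorphism moves [z0] to the origin; [f - g] is bounded by 2, so the preceding lemma on
    functions vanishing near 0 applies. *)
Lemma identity_principle (f g : C -> C) (z0 : C) (r : R) :
  self_map_disk f -> self_map_disk g -> disk z0 -> 0 < r ->
  (forall z, disk z -> Cmod (z - z0)%C < r -> f z = g z) ->
  forall z, disk z -> f z = g z.
Proof.
  intros [Hf Mf] [Hg Mg] H0 Hr E z Hz.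
  assert (H0' := disk_opp z0 H0).
  set (T := blaschke_factor (- z0)).
  assert (HT : holomorphic_disk T) by now apply holomorphic_blaschke_factor.
  assert (MT : forall w, disk w -> disk (T w)) by (intros; now apply disk_blaschke_factor).
  assert (D0 : disk 0%C) by (unfold disk; rewrite Cmod_0; lra).
  assert (T0 : T 0%C = z0).
  { unfold T, blaschke_factor. rewrite Cmult_0_r. field. }
  destruct (HT 0%C D0) as [l Hl].
  destruct (is_Cderive_continuous T _ l Hl r Hr) as [d [D1 D2]].
  assert (K : (f (T (blaschke_factor z0 z)) - g (T (blaschke_factor z0 z)))%C = 0%C).
  { apply (zero_near_0_zero (fun w => f (T w) - g (T w))%C (Rmin d 1) 2).
    - intros w Hw. destruct (holomorphic_comp f T Hf HT MT w Hw) as [a Ha].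
      destruct (holomorphic_comp g T Hg HT MT w Hw) as [b Hb].
      eexists. apply (is_Cderive_minus (fun w => f (T w)) (fun w => g (T w))); eassumption.
    - apply Rmin_pos; lra.
    - intros w Hw. eapply Rle_trans; [apply Cmod_sub_le|].
      assert (A1 := Mf _ (MT w Hw)). assert (A2 := Mg _ (MT w Hw)). unfold disk in A1, A2. lra.
    - intros w Hw. assert (Hw1 : disk w).
      { unfold disk. eapply Rlt_le_trans; [exact Hw|apply Rmin_r]. }
      rewrite E; [ring|now apply MT|].
      rewrite <- T0 at 1. apply D2. replace (w - 0)%C with w by ring.
      eapply Rlt_le_trans; [exact Hw|apply Rmin_l].
    - now apply disk_blaschke_factor. }
  unfold T in K. rewrite blaschke_factor_opp in K by assumption.
  replace (f z) with (f z - g z + g z)%C by ring. rewrite K. ring.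
Qed.

Lemma Im_div (n d : C) : d <> 0%C -> Im (n / d)%C = Im (n * Cconj d)%C / Cmod d ^ 2.
Proof.
  intros Hd. assert (H := Hd). apply Cmod_gt_0 in H.
  replace (n * Cconj d)%C with ((Cmod d ^ 2)%R * (n / d))%C.
  - rewrite im_scal_l. field. lra.
  - rewrite Cmod2_conj. field. assumption.
Qed.

Lemma Im_conj_neq (w q : C) : 0 <= Im w -> 0 < Im q -> (w - Cconj q)%C <> 0%C.
Proof.
  intros Hw Hq E. apply (f_equal Im) in E. destruct w, q. simpl in *. lra.
Qed.

(** It turns bounds on the pseudohyperbolic distance [|w - q| / |w - Cconj q|] into inequalities
    between imaginary parts. *)
Lemma Cmod2_sub_conj (w q : C) :
  Cmod (w - Cconj q)%C ^ 2 = Cmod (w - q)%C ^ 2 + 4 * (Im w * Im q).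
Proof. rewrite !Cmod2_alt. destruct w, q. simpl. ring. Qed.

(** This is the Schwarz-Pick inequality for [q] between half planes: pseudohyperbolic distances do
    not increase. Passing to complements of squares gives [s t X^2 <= Im (q V) Im b Y^2], with
    [X = |q V - Cconj b|] and [Y] its analogue for [V]. As [X >= Im b], one factor [Im b]
    cancels. *)
Lemma harnack_half_plane (q : C -> C) (R0 : R) :
  (forall W, R0 < Im W -> ex_Cderive q W) -> (forall W, R0 < Im W -> 0 <= Im (q W)) ->
  forall V W, R0 < Im V -> R0 < Im W ->
  Im (q W) * ((Im V - R0) * (Im W - R0))
  <= Im (q V) * ((Re V - Re W) ^ 2 + (Im V + Im W - 2 * R0) ^ 2).
Proof.
  intros Hq Hpos V W HV HW.
  assert (Hb := Hpos W HW). set (b := q W) in *.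
  assert (Ha := Hpos V HV).
  (* If [Im b = 0], the denominator of [g] below could vanish, but the claim is then trivial. *)
  destruct (Rle_lt_or_eq_dec _ _ Hb) as [Hb'|Hb'].
  2:{ rewrite <- Hb', Rmult_0_l. apply Rmult_le_pos; [assumption|].
      generalize (pow2_ge_0 (Re V - Re W)) (pow2_ge_0 (Im V + Im W - 2 * R0)). lra. }
  set (cR := (Ci * R0)%C).
  set (A := (W - cR)%C).
  assert (HA : Im A = Im W - R0) by (unfold A, cR; destruct W; simpl; ring).
  (* A conformal map of the disk onto [Im > R0] with [S 0 = W]; [zeta] below is the preimage of
     [V]. *)
  set (S := fun z => (cR + (A - Cconj A * z) / (1 - z))%C).
  assert (H1 : forall z, disk z -> (1 - z)%C <> 0%C).
  { intros z Hz E. unfold disk in Hz. replace z with (1 - (1 - z))%C in Hz by ring.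
    rewrite E in Hz. replace (1 - 0)%C with (RtoC 1) in Hz by ring. rewrite Cmod_1 in Hz. lra. }
  assert (HS : forall z, disk z -> R0 < Im (S z)).
  { intros z Hz. unfold S. rewrite im_plus, Im_div by now apply H1.
    replace (Im cR) with R0 by (unfold cR; simpl; ring).
    replace (Im ((A - Cconj A * z) * Cconj (1 - z))%C) with (Im A * (1 - Cmod z ^ 2)).
    2:{ rewrite Cmod2_alt. destruct A, z. simpl. ring. }
    assert (0 < Im A * (1 - Cmod z ^ 2) / Cmod (1 - z)%C ^ 2); [|lra].
    apply Rdiv_lt_0_compat; [apply Rmult_lt_0_compat; [lra|now apply Cmod_sq_lt]|].
    apply pow_lt, Cmod_gt_0. now apply H1. }
  assert (HdS : holomorphic_disk S).
  { intros z Hz. eexists. apply (is_Cderive_plus (fun _ => cR)); [apply is_Cderive_const|].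
    apply (is_Cderive_div (fun z => A - Cconj A * z)%C (fun z => 1 - z)%C); [| |now apply H1].
    - apply (is_Cderive_minus (fun _ => A)); [apply is_Cderive_const|].
      apply (is_Cderive_mult (fun _ => Cconj A) (fun z => z));
        [apply is_Cderive_const|apply is_Cderive_id].
    - apply (is_Cderive_minus (fun _ => RtoC 1) (fun z => z));
        [apply is_Cderive_const|apply is_Cderive_id]. }
  set (g := fun z => ((q (S z) - b) / (q (S z) - Cconj b))%C).
  assert (Hg : holomorphic_disk g).
  { intros z Hz. destruct (Hq _ (HS z Hz)) as [l Hl]. destruct (HdS z Hz) as [l' Hl'].
    assert (HqS := is_Cderive_comp q S z _ _ Hl Hl').
    eexists. apply (is_Cderive_div (fun z => q (S z) - b)%C (fun z => q (S z) - Cconj b)%C).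
    - apply (is_Cderive_minus (fun z => q (S z)) (fun _ => b)); [exact HqS|apply is_Cderive_const].
    - apply (is_Cderive_minus (fun z => q (S z)) (fun _ => Cconj b));
        [exact HqS|apply is_Cderive_const].
    - apply Im_conj_neq; [now apply Hpos, HS|assumption]. }
  set (zeta := ((V - cR - A) / (V - cR - Cconj A))%C).
  assert (HVc : Im (V - cR)%C = Im V - R0) by (unfold cR; destruct V; simpl; ring).
  assert (HV0 : (V - cR - Cconj A)%C <> 0%C) by (apply Im_conj_neq; lra).
  assert (EY := Cmod2_sub_conj (V - cR)%C A).
  assert (Hzeta : disk zeta).
  { unfold disk, zeta. rewrite Cmod_div by assumption.
    apply Cmod_gt_0 in HV0. apply (Rdiv_lt_1 (Cmod (V - cR - A)%C)); [assumption|].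
    assert (0 <= Cmod (V - cR - A)%C) by apply Cmod_ge_0.
    assert (0 < Im (V - cR)%C * Im A) by (apply Rmult_lt_0_compat; lra). nra. }
  assert (HA2 : (A - Cconj A)%C <> 0%C) by (apply Im_conj_neq; lra).
  assert (ES : S zeta = V).
  { unfold S. transitivity (cR + (V - cR))%C; [|ring]. f_equal. unfold zeta.
    field. split; [exact HV0|].
    replace (V - cR - Cconj A - (V - cR - A))%C with (A - Cconj A)%C by ring. assumption. }
  assert (Hs := schwarz g Hg).
  assert (Hle : Cmod (g zeta) <= Cmod zeta).
  { apply Hs; [| |assumption].
    - intros z Hz. unfold g. assert (Hp := Hpos _ (HS z Hz)).
      assert (E := Cmod2_sub_conj (q (S z)) b).
      assert (Hn : (q (S z) - Cconj b)%C <> 0%C) by now apply Im_conj_neq.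
      rewrite Cmod_div by assumption. apply Cmod_gt_0 in Hn.
      apply (Rdiv_le_1 (Cmod (q (S z) - b)%C)); [assumption|].
      assert (0 <= Cmod (q (S z) - b)%C) by apply Cmod_ge_0.
      assert (0 <= Im (q (S z)) * Im b) by (apply Rmult_le_pos; lra). nra.
    - unfold g. replace (S 0%C) with W.
      + fold b. unfold Cdiv. ring.
      + unfold S, A. rewrite Cmult_0_r. field. }
  unfold g in Hle. rewrite ES in Hle. unfold zeta in Hle.
  assert (Hn : (q V - Cconj b)%C <> 0%C) by now apply Im_conj_neq.
  rewrite !Cmod_div in Hle by assumption.
  assert (EX := Cmod2_sub_conj (q V) b).
  assert (HX : (Im b) ^ 2 <= Cmod (q V - Cconj b)%C ^ 2).
  { rewrite Cmod2_alt. replace (Im (q V - Cconj b)%C) with (Im (q V) + Im b)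
      by (destruct (q V), b; simpl; ring).
    generalize (pow2_ge_0 (Re (q V - Cconj b)%C)). nra. }
  replace ((Re V - Re W) ^ 2 + (Im V + Im W - 2 * R0) ^ 2)
    with (Cmod (V - cR - Cconj A)%C ^ 2).
  2:{ rewrite Cmod2_alt. unfold A, cR. destruct V, W. simpl. ring. }
  rewrite HVc, HA in EY.
  apply Cmod_gt_0 in Hn, HV0.
  set (x := Cmod (q V - b)%C) in *. set (X := Cmod (q V - Cconj b)%C) in *.
  set (y := Cmod (V - cR - A)%C) in *. set (Y := Cmod (V - cR - Cconj A)%C) in *.
  assert (Hx0 : 0 <= x) by apply Cmod_ge_0. assert (Hy0 : 0 <= y) by apply Cmod_ge_0.
  set (s := Im V - R0) in *. set (t := Im W - R0) in *.
  assert (H2 : x * Y <= y * X).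
  { apply Rmult_le_compat_r with (r := X * Y) in Hle; [|nra].
    replace (x / X * (X * Y)) with (x * Y) in Hle by (field; lra).
    replace (y / Y * (X * Y)) with (y * X) in Hle by (field; lra). exact Hle. }
  assert (H3 : (x * Y) ^ 2 <= (y * X) ^ 2) by (apply pow_incr; split; [nra|assumption]).
  assert (H4 : (s * t) * X ^ 2 <= (Im (q V) * Im b) * Y ^ 2).
  { replace ((x * Y) ^ 2) with (x ^ 2 * Y ^ 2) in H3 by ring.
    replace ((y * X) ^ 2) with (y ^ 2 * X ^ 2) in H3 by ring.
    replace (x ^ 2) with (X ^ 2 - 4 * (Im (q V) * Im b)) in H3 by lra.
    replace (y ^ 2) with (Y ^ 2 - 4 * (s * t)) in H3 by lra. lra. }
  assert (Hst : 0 < s * t) by (apply Rmult_lt_0_compat; unfold s, t; lra).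
  apply Rmult_le_reg_l with (Im b); [assumption|].
  apply Rle_trans with (s * t * X ^ 2); [|lra].
  replace (Im b * (Im b * (s * t))) with (s * t * Im b ^ 2) by ring.
  apply Rmult_le_compat_l; lra.
Qed.

(** * Rigidity of hyperbolic contractions of a half plane *)

Lemma Im_abs_le_Cmod (z : C) : Rabs (Im z) <= Cmod z.
Proof. eapply Rle_trans; [apply Rmax_r|apply Rmax_Cmod]. Qed.

Lemma Im_le_Cmod (z : C) : Im z <= Cmod z.
Proof. eapply Rle_trans; [apply Rle_abs|apply Im_abs_le_Cmod]. Qed.

Lemma Rsqr_sum_sub_le (a b c d M : R) :
  Rabs a <= M -> Rabs b <= M -> Rabs c <= M -> Rabs d <= M ->
  (a - b) ^ 2 + (c + d) ^ 2 <= 8 * M ^ 2.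
Proof.
  intros Ha Hb Hc Hd.
  apply Rabs_le_between in Ha, Hb, Hc, Hd. nra.
Qed.

(* A Hopf lemma: a nonnegative harmonic function on a half plane that decays
   faster than [1 / |w|] along some non-tangential sequence vanishes. *)
Lemma half_plane_hopf (q : C -> C) (R0 K : R) : 0 <= R0 ->
  (forall W, R0 < Im W -> ex_Cderive q W) -> (forall W, R0 < Im W -> 0 <= Im (q W)) ->
  (forall A eps, 0 < eps -> exists w, A < Im w /\ Cmod w <= K * Im w /\
     Cmod w * Im (q w) <= eps) ->
  forall W, R0 < Im W -> Im (q W) = 0.
Proof.
  intros HR Hd Hp Hw W HW.
  apply Rle_antisym; [|now apply Hp].
  apply Rmult_le_reg_r with (Im W - R0); [lra|]. rewrite Rmult_0_l.
  apply le_epsilon. intros eps He. rewrite Rplus_0_l.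
  (* Harnack's inequality leaves [8 |w|^2 Im (q w)]. One factor [|w|] is used up by the decay
     hypothesis, the other is at most [(|K| + 1) Im w], and [Im w <= 2 (Im w - R0)] supplies the
     last factor 2. *)
  set (e := eps / (16 * (Rabs K + 1))).
  assert (HK : 0 <= Rabs K) by apply Rabs_pos.
  assert (He' : 0 < e) by (apply Rdiv_lt_0_compat; lra).
  destruct (Hw (Rmax (2 * R0 + 1) (Cmod W + 1)) e He') as [w [W1 [W2 W3]]].
  assert (HA : 2 * R0 + 1 < Im w) by (eapply Rle_lt_trans; [apply Rmax_l|exact W1]).
  assert (HB : Cmod W + 1 < Im w) by (eapply Rle_lt_trans; [apply Rmax_r|exact W1]).
  assert (HI := Im_le_Cmod w).
  assert (Hq := harnack_half_plane q R0 Hd Hp w W ltac:(lra) HW).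
  assert (HS : (Re w - Re W) ^ 2 + (Im w + Im W - 2 * R0) ^ 2 <= 8 * Cmod w ^ 2).
  { replace (Im w + Im W - 2 * R0) with ((Im w - R0) + (Im W - R0)) by ring.
    apply Rsqr_sum_sub_le.
    - apply re_le_Cmod.
    - eapply Rle_trans; [apply re_le_Cmod|lra].
    - apply Rabs_le. lra.
    - apply Rabs_le. generalize (Im_le_Cmod W). lra. }
  assert (Hqw := Hp w ltac:(lra)).
  assert (H1 : Im (q W) * ((Im w - R0) * (Im W - R0)) <= 8 * Cmod w * e).
  { eapply Rle_trans; [exact Hq|].
    eapply Rle_trans; [apply Rmult_le_compat_l; [exact Hqw|exact HS]|].
    replace (Im (q w) * (8 * Cmod w ^ 2)) with (8 * Cmod w * (Cmod w * Im (q w))) by ring.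
    apply Rmult_le_compat_l; lra. }
  assert (HKw : Cmod w <= (Rabs K + 1) * Im w).
  { generalize (Rle_abs K). nra. }
  assert (H2 : 8 * Cmod w * e <= (Im w - R0) * eps).
  { apply Rle_trans with (8 * ((Rabs K + 1) * Im w) * e); [nra|].
    replace (8 * ((Rabs K + 1) * Im w) * e) with (Im w / 2 * eps) by (unfold e; field; lra).
    nra. }
  apply Rmult_le_reg_l with (Im w - R0); [lra|]. lra.
Qed.

Section Contraction.

Variables (phi phi' : C -> C) (R0 : R).
Hypothesis HR : 0 <= R0.
Hypothesis phi_pos : forall W, R0 < Im W -> 0 < Im (phi W).
Hypothesis phi_derive : forall W, R0 < Im W -> is_Cderive phi W (phi' W).
(* [phi] does not increase the hyperbolic metric [|dW| / Im W]. *)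
Hypothesis phi_contr : forall W, R0 < Im W -> Cmod (phi' W) * Im W <= Im (phi W).

Lemma is_derive_Im_line (p d : C) (t : R) : R0 < Im (p + t * d)%C ->
  is_derive (fun s : R => Im (phi (p + s * d)%C)) t (Im (phi' (p + t * d) * d)%C).
Proof.
  intros H.
  assert (E : forall z, Im z = Re (- Ci * z)%C) by (intros z; destruct z; simpl; ring).
  rewrite E, Cmult_assoc.
  eapply is_derive_ext; [intros s; symmetry; apply E|].
  apply is_derive_line. now apply phi_derive.
Qed.

(** The derivative of [Im phi / t] has the sign of [Im (phi' i) t - Im phi], which [phi_contr] makes
    nonpositive. *)
Lemma vertical_ratio_decr (x y1 y2 : R) : R0 < y1 -> y1 <= y2 ->
  Im (phi (x + y2 * Ci)%C) / y2 <= Im (phi (x + y1 * Ci)%C) / y1.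
Proof.
  intros H1 H12.
  destruct (MVT_gen (fun t => Im (phi (x + t * Ci)%C) / t) y1 y2
    (fun t => (Im (phi' (x + t * Ci) * Ci)%C * t - Im (phi (x + t * Ci)%C) * 1) / t ^ 2))
    as [c [Hc E]].
  - rewrite Rmin_left, Rmax_right by lra. intros t Ht.
    apply (is_derive_div (fun t => Im (phi (x + t * Ci)%C)) (fun t => t)); [| |lra].
    + apply is_derive_Im_line. simpl. lra.
    + apply (is_derive_id (K := R_AbsRing)).
  - rewrite Rmin_left, Rmax_right by lra. intros t Ht.
    apply derivable_continuous_pt. eexists. apply is_derive_Reals.
    apply (is_derive_div (fun t => Im (phi (x + t * Ci)%C)) (fun t => t)); [| |lra].
    + apply is_derive_Im_line. simpl. lra.
    + apply (is_derive_id (K := R_AbsRing)).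
  - rewrite Rmin_left, Rmax_right in Hc by lra.
    assert (HI : Im (x + c * Ci)%C = c) by (simpl; ring).
    assert (Hk := phi_contr (x + c * Ci)%C ltac:(lra)). rewrite HI in Hk.
    assert (Hi := Im_le_Cmod (phi' (x + c * Ci) * Ci)%C).
    rewrite Cmod_mult, Cmod_Ci, Rmult_1_r in Hi.
    assert (Hc2 : 0 < / c ^ 2) by (apply Rinv_0_lt_compat; nra).
    rewrite (Rdiv_def (_ - _)) in E.
    assert (Im (phi' (x + c * Ci) * Ci)%C * c - Im (phi (x + c * Ci)%C) * 1 <= 0) by nra.
    set (g := Im (phi' (x + c * Ci) * Ci)%C * c - Im (phi (x + c * Ci)%C) * 1) in *.
    assert (g * / c ^ 2 <= 0) by nra. nra.
Qed.

(** By [phi_contr], [ln (Im phi)] is [1 / y]-Lipschitz on the line at height [y]; then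
    [exp (- k) >= 1 - k]. *)
Lemma horizontal_ratio (x1 x2 y : R) : R0 < y ->
  (1 - Rabs (x1 - x2) / y) * Im (phi (x2 + y * Ci)%C) <= Im (phi (x1 + y * Ci)%C).
Proof.
  intros Hy.
  assert (HI : forall t : R, Im (y * Ci + t * 1)%C = y) by (intros t; simpl; ring).
  assert (EX : forall t : R, (t + y * Ci)%C = (y * Ci + t * 1)%C) by (intros t; ring).
  rewrite !EX.
  assert (Hpos : forall t : R, 0 < Im (phi (y * Ci + t * 1)%C)).
  { intros t. apply phi_pos. rewrite HI. exact Hy. }
  set (h := fun t : R => ln (Im (phi (y * Ci + t * 1)%C))).
  assert (Hd : forall t, is_derive h t
    (Im (phi' (y * Ci + t * 1) * 1)%C * / Im (phi (y * Ci + t * 1)%C))).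
  { intros t. apply (is_derive_comp (V := R_NormedModule) ln
      (fun t : R => Im (phi (y * Ci + t * 1)%C))).
    - apply is_derive_Reals, derivable_pt_lim_ln, Hpos.
    - apply is_derive_Im_line. rewrite HI. exact Hy. }
  assert (Hb' : Rabs (h x2 - h x1) <= / y * Rabs (x2 - x1)).
  { apply (bounded_variation h (fun t : R =>
      Im (phi' (y * Ci + t * 1) * 1)%C * / Im (phi (y * Ci + t * 1)%C)) (/ y) x1 x2). intros t _. split; [apply Hd|].
    rewrite Rabs_mult, Rabs_inv, (Rabs_right (Im (phi _)))
      by (apply Rle_ge, Rlt_le, Hpos).
    assert (Hk := phi_contr (y * Ci + t * 1)%C ltac:(rewrite HI; exact Hy)).
    rewrite HI in Hk.
    assert (Hi := Im_abs_le_Cmod (phi' (y * Ci + t * 1) * 1)%C).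
    rewrite Cmod_mult, Cmod_1, Rmult_1_r in Hi.
    apply Rmult_le_reg_r with (y * Im (phi (y * Ci + t * 1)%C)).
    { apply Rmult_lt_0_compat; [lra|apply Hpos]. }
    specialize (Hpos t).
    set (P := Im (phi (y * Ci + t * 1)%C)) in *.
    replace (/ y * (y * P)) with P by (field; lra).
    match goal with |- ?a * / P * (y * P) <= P =>
      replace (a * / P * (y * P)) with (a * y) by (field; lra) end.
    nra. }
  clear Hd. apply Rabs_le_between in Hb'.
  rewrite (Rabs_minus_sym x2 x1) in Hb'.
  replace (Rabs (x1 - x2) / y) with (/ y * Rabs (x1 - x2)) by (unfold Rdiv; ring).
  set (k := / y * Rabs (x1 - x2)) in *.
  assert (Hle : h x2 - k <= h x1) by lra.
  assert (Hexp : exp (h x2) * exp (- k) <= exp (h x1)).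
  { rewrite <- exp_plus. destruct Hle as [Hle|Hle].
    - left. apply exp_increasing. lra.
    - right. f_equal. lra. }
  unfold h in Hexp. rewrite !exp_ln in Hexp by apply Hpos.
  assert (H1 := exp_ineq1_le (- k)). specialize (Hpos x2). nra.
Qed.

(* By [vertical_ratio_decr], [c] is the limit of [Im phi / Im W] along the imaginary
   axis; by [horizontal_ratio], it is the limit along every vertical line. *)
Lemma angular_slope : exists c, 0 <= c /\
  (forall W, R0 < Im W -> c * Im W <= Im (phi W)) /\
  (forall eps, 0 < eps -> exists Y, forall y : R, Y <= y -> R0 < y ->
     Im (phi (y * Ci)%C) <= (c + eps) * y).
Proof.
  set (m := fun y : R => Im (phi (0%R + y * Ci)%C) / y).
  assert (Hm : forall y, R0 < y -> 0 < m y).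
  { intros y Hy. apply Rdiv_lt_0_compat; [|lra]. apply phi_pos. simpl. lra. }
  (* The slope is [c = - s], the infimum of [m], obtained as a supremum of [- m]. *)
  destruct (completeness (fun r => exists y, R0 < y /\ r = - m y)) as [s [Hs1 Hs2]].
  { exists 0. intros r [y [Hy ->]]. generalize (Hm y Hy). lra. }
  { exists (- m (R0 + 1)), (R0 + 1). split; [lra|reflexivity]. }
  assert (Hc0 : 0 <= - s).
  { assert (s <= 0); [|lra]. apply Hs2. intros r [y [Hy ->]]. generalize (Hm y Hy). lra. }
  assert (Hc1 : forall y, R0 < y -> - s <= m y).
  { intros y Hy. assert (- m y <= s); [|lra]. apply Hs1. now exists y. }
  exists (- s). split; [assumption|]. split.
  - intros W HW. set (x := Re W). set (y := Im W) in *.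
    assert (EW : W = (x + y * Ci)%C) by (unfold x, y; destruct W; apply injective_projections;
      simpl; ring).
    rewrite EW. clearbody x y. clear EW W.
    apply le_epsilon. intros eps He.
    (* A height so large that the horizontal loss [|x| / Y] is at most 1 and costs at most [eps]
       after multiplication by [c y]. *)
    set (Y := Rmax y ((Rabs x + 1) * (- s * y / eps + 1))).
    assert (Hx : 0 <= Rabs x) by apply Rabs_pos.
    assert (Hd : 0 <= - s * y / eps).
    { apply Rmult_le_pos; [nra|]. apply Rlt_le, Rinv_0_lt_compat. exact He. }
    assert (Y1 : y <= Y) by apply Rmax_l.
    assert (Y2 : (Rabs x + 1) * (- s * y / eps + 1) <= Y) by apply Rmax_r.
    assert (V := vertical_ratio_decr x y Y HW Y1).
    assert (V2 := horizontal_ratio x 0 Y ltac:(lra)). rewrite Rminus_0_r in V2.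
    assert (V3 := Hc1 Y ltac:(lra)). unfold m in V3.
    set (p := Im (phi (x + y * Ci)%C)) in *. set (P := Im (phi (x + Y * Ci)%C)) in *.
    set (P0 := Im (phi (0%R + Y * Ci)%C)) in *.
    assert (Hk : Rabs x / Y <= 1).
    { apply (Rdiv_le_1 (Rabs x)); [lra|]. nra. }
    assert (V4 : (1 - Rabs x / Y) * - s <= p / y).
    { eapply Rle_trans; [|exact V].
      apply Rle_trans with ((1 - Rabs x / Y) * (P0 / Y)); [apply Rmult_le_compat_l; lra|].
      replace ((1 - Rabs x / Y) * (P0 / Y)) with ((1 - Rabs x / Y) * P0 / Y)
        by (unfold Rdiv; ring).
      apply Rmult_le_compat_r; [apply Rlt_le, Rinv_0_lt_compat; lra|exact V2]. }
    apply Rmult_le_compat_r with (r := y) in V4; [|lra].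
    replace (p / y * y) with p in V4 by (field; lra).
    assert (Hq : Rabs x / Y * (- s) * y <= eps).
    { apply Rmult_le_reg_r with Y; [lra|].
      replace (Rabs x / Y * - s * y * Y) with (Rabs x * (- s * y)) by (field; lra).
      assert (Hsy : - s * y = eps * (- s * y / eps)) by (field; lra).
      rewrite Hsy. set (D := - s * y / eps) in *.
      assert (Rabs x * D <= Y) by nra. nra. }
    lra.
  - intros eps He.
    assert (HY : exists Y, R0 < Y /\ m Y < - s + eps).
    { apply NNPP. intros N. assert (s <= s - eps); [|lra].
      apply Hs2. intros r [y [Hy ->]].
      apply Rnot_lt_le. intros L. apply N. exists y. split; [assumption|lra]. }
    destruct HY as [Y [HY1 HY2]]. exists Y. intros y Hy Hy0.
    assert (V := vertical_ratio_decr 0 Y y HY1 Hy). fold (m y) (m Y) in V.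
    replace (y * Ci)%C with (0%R + y * Ci)%C by ring.
    replace (Im (phi (0%R + y * Ci)%C)) with (m y * y) by (unfold m; field; lra).
    apply Rmult_le_compat_r; lra.
Qed.

Lemma half_plane_rigidity (K : R) :
  (forall A eps, 0 < eps -> exists w, A < Im w /\ Cmod w <= K * Im w /\
     Cmod w * Cmod (phi w - w)%C <= eps) ->
  forall W, R0 < Im W -> phi W = W.
Proof.
  intros Hw.
  destruct angular_slope as [c [Hc0 [Hc1 Hc2]]].
  (* With [s = Im w], Harnack's inequality for [Im (phi - c W)] carries the bound [e s] from [s i]
     to [w] with the factor [4 (K^2 + 4)], so [Im (phi w) - c s <= eps s / 2]. On the other hand
     [Im (phi w) >= s - 1], and the height [2 / eps] makes 1 less than [eps s / 2]. *)
  assert (Hc : 1 <= c).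
  { apply le_epsilon. intros eps He.
    set (e := eps / (8 * (K ^ 2 + 4))).
    assert (HK : 0 <= K ^ 2) by apply pow2_ge_0.
    assert (He' : 0 < e) by (apply Rdiv_lt_0_compat; lra).
    destruct (Hc2 e He') as [Y HY].
    set (A := Rmax (Rmax Y (2 * R0 + 1)) (2 / eps)).
    destruct (Hw A 1 Rlt_0_1) as [w [W1 [W2 W3]]].
    set (s := Im w) in *.
    assert (A1 : Rmax Y (2 * R0 + 1) < s) by (eapply Rle_lt_trans; [apply Rmax_l|exact W1]).
    assert (A2 : 2 / eps < s) by (eapply Rle_lt_trans; [apply Rmax_r|exact W1]).
    assert (A3 : Y < s) by (eapply Rle_lt_trans; [apply Rmax_l|exact A1]).
    assert (A4 : 2 * R0 + 1 < s) by (eapply Rle_lt_trans; [apply Rmax_r|exact A1]).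
    specialize (HY s ltac:(lra) ltac:(lra)).
    assert (Hcw : Cmod w >= 1) by (generalize (Im_le_Cmod w); fold s; lra).
    assert (HIm : s - 1 <= Im (phi w)).
    { assert (Cmod (phi w - w)%C <= 1) by (generalize (Cmod_ge_0 (phi w - w)%C); nra).
      generalize (Im_abs_le_Cmod (phi w - w)%C). intros Hi.
      assert (Hi2 := proj1 (Rabs_le_between _ _) Hi).
      replace (Im (phi w - w)%C) with (Im (phi w) - s) in Hi2
        by (unfold s; destruct (phi w), w; simpl; ring). lra. }
    set (q := fun W => (phi W - c * W)%C).
    assert (Eq : forall W, Im (q W) = Im (phi W) - c * Im W).
    { intros W. unfold q. destruct (phi W), W. simpl. ring. }
    assert (Hh : Im (q w) * ((Im (s * Ci)%C - R0) * (Im w - R0)) <= Im (q (s * Ci)%C)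
       * ((Re (s * Ci)%C - Re w) ^ 2 + (Im (s * Ci)%C + Im w - 2 * R0) ^ 2)).
    { apply harnack_half_plane.
      - intros W HW. eexists. apply (is_Cderive_minus phi (fun W => c * W)%C).
        + now apply phi_derive.
        + apply (is_Cderive_mult (fun _ => RtoC c) (fun W => W));
            [apply is_Cderive_const|apply is_Cderive_id].
      - intros W HW. rewrite Eq. specialize (Hc1 W HW). lra.
      - simpl. lra.
      - fold s. lra. }
    rewrite !Eq in Hh. fold s in Hh.
    replace (Im (s * Ci)%C) with s in Hh by (simpl; ring).
    replace (Re (s * Ci)%C) with 0 in Hh by (simpl; ring).
    assert (Hre : (0 - Re w) ^ 2 <= K ^ 2 * s ^ 2).
    { replace ((0 - Re w) ^ 2) with (Rabs (Re w) ^ 2) by (rewrite pow2_abs; ring).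
      replace (K ^ 2 * s ^ 2) with ((K * s) ^ 2) by ring.
      apply pow_incr. split; [apply Rabs_pos|].
      eapply Rle_trans; [apply re_le_Cmod|exact W2]. }
    set (u := Im (phi w) - c * s) in *. set (v := Im (phi (s * Ci)%C) - c * s) in *.
    assert (Hv : 0 <= v <= e * s).
    { split; [|unfold v; lra]. unfold v.
      specialize (Hc1 (s * Ci)%C). replace (Im (s * Ci)%C) with s in Hc1 by (simpl; ring).
      specialize (Hc1 ltac:(lra)). lra. }
    assert (Hu : 0 <= u) by (specialize (Hc1 w ltac:(fold s; lra)); fold s in Hc1; unfold u; lra).
    assert (Hb : (0 - Re w) ^ 2 + (s + s - 2 * R0) ^ 2 <= (K ^ 2 + 4) * s ^ 2) by nra.
    assert (Hu2 : u * (s ^ 2 / 4) <= e * s * ((K ^ 2 + 4) * s ^ 2)).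
    { apply Rle_trans with (u * ((s - R0) * (s - R0))).
      - apply Rmult_le_compat_l; [assumption|]. nra.
      - eapply Rle_trans; [exact Hh|]. apply Rmult_le_compat; try lra.
        generalize (pow2_ge_0 (0 - Re w)) (pow2_ge_0 (s + s - 2 * R0)). lra. }
    assert (Hu3 : u <= eps / 2 * s).
    { apply Rmult_le_reg_r with (s ^ 2 / 4); [nra|].
      replace (eps / 2 * s * (s ^ 2 / 4)) with (e * s * ((K ^ 2 + 4) * s ^ 2))
        by (unfold e; field; lra). exact Hu2. }
    assert (Hs1 : 1 < eps / 2 * s).
    { apply Rmult_lt_compat_l with (r := eps / 2) in A2; [|lra].
      replace (eps / 2 * (2 / eps)) with 1 in A2 by (field; lra). exact A2. }
    apply Rmult_le_reg_r with s; [lra|]. unfold u in Hu3. nra. }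
  assert (Himp : forall W, R0 < Im W -> Im (phi W - W)%C = 0).
  { apply (half_plane_hopf (fun W => phi W - W)%C R0 K HR).
    - intros W HW. eexists. apply (is_Cderive_minus phi (fun W => W));
        [now apply phi_derive|apply is_Cderive_id].
    - intros W HW. replace (Im (phi W - W)%C) with (Im (phi W) - Im W)
        by (destruct (phi W), W; simpl; ring).
      specialize (Hc1 W HW). nra.
    - intros A eps He. destruct (Hw A eps He) as [w [W1 [W2 W3]]].
      exists w. repeat split; try assumption.
      eapply Rle_trans; [|exact W3]. apply Rmult_le_compat_l; [apply Cmod_ge_0|apply Im_le_Cmod]. }
  (* [p = phi - id] is real-valued, so [Im (i p^2) = p^2] is again nonnegative and decays. *)
  assert (Hp2 : forall W, R0 < Im W -> Im (Ci * ((phi W - W) * (phi W - W)))%C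
     = Cmod (phi W - W)%C ^ 2).
  { intros W HW. specialize (Himp W HW). rewrite Cmod2_alt, Himp.
    destruct (phi W - W)%C as [a b]. simpl in *. subst b. ring. }
  intros W HW.
  assert (H0 : Im (Ci * ((phi W - W) * (phi W - W)))%C = 0).
  { apply (half_plane_hopf (fun W => Ci * ((phi W - W) * (phi W - W)))%C R0 K HR);
      [| | |assumption].
    - intros V HV. eexists.
      assert (Hd := is_Cderive_minus phi (fun W => W) V _ _ (phi_derive V HV) (is_Cderive_id V)).
      apply (is_Cderive_mult (fun _ => Ci)); [apply is_Cderive_const|].
      apply (is_Cderive_mult (fun W => phi W - W)%C (fun W => phi W - W)%C); exact Hd.
    - intros V HV. rewrite Hp2 by assumption. apply pow2_ge_0.
    - intros A eps He.
      (* The two extra bounds give [|w| >= 1] and [|w| p <= 1], hence [p <= 1] and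
         [|w| p^2 <= |w| p <= eps]. *)
      destruct (Hw (Rmax A (R0 + 1)) (Rmin eps 1) ltac:(apply Rmin_pos; lra))
        as [w [W1 [W2 W3]]].
      assert (A1 : A < Im w) by (eapply Rle_lt_trans; [apply Rmax_l|exact W1]).
      assert (A2 : R0 + 1 < Im w) by (eapply Rle_lt_trans; [apply Rmax_r|exact W1]).
      exists w. repeat split; try assumption. rewrite Hp2 by lra.
      assert (E1 := Rmin_l eps 1). assert (E2 := Rmin_r eps 1).
      assert (Hi := Im_le_Cmod w).
      set (p := Cmod (phi w - w)%C) in *. assert (0 <= p) by apply Cmod_ge_0.
      assert (p <= 1) by nra. nra. }
  rewrite Hp2 in H0 by assumption.
  assert (H1 : Cmod (phi W - W)%C = 0) by (generalize (Cmod_ge_0 (phi W - W)%C); nra).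
  apply Cmod_eq_0 in H1.
  replace (phi W) with (phi W - W + W)%C by ring. rewrite H1. ring.
Qed.

End Contraction.

(** * Boundary behaviour of finite Blaschke products *)

Lemma C_geometric_cauchy (u : nat -> C) (K : R) :
  (forall n, Cmod (u (S n) - u n)%C <= K * (/ 2) ^ n) ->
  exists z, forall eps, 0 < eps -> exists N, forall n, (N <= n)%nat -> Cmod (u n - z)%C < eps.
Proof.
  intros H.
  destruct (ex_series_le (V := C_R_CompleteNormedModule) (fun n => (u (S n) - u n)%C)
    (fun n => K * (/ 2) ^ n)) as [l Hl].
  - intros n. rewrite <- Cmod_norm. apply H.
  - apply (ex_series_scal (V := R_NormedModule)). apply ex_series_geom.
    rewrite Rabs_right; lra.
  - exists (u 0%nat + l)%C. intros eps He.
    destruct (proj1 (filterlim_locally _ _) Hl (mkposreal (eps / 2) ltac:(lra))) as [N HN].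
    exists (S N). intros n Hn. destruct n as [|n]; [lia|].
    specialize (HN n ltac:(lia)).
    assert (E : sum_n (G := C_R_CompleteNormedModule) (fun n => (u (S n) - u n)%C) n
      = (u (S n) - u 0%nat)%C).
    { clear. induction n as [|n IH]; [now rewrite sum_O|].
      rewrite sum_Sn, IH. change (@plus C_R_CompleteNormedModule) with Cplus.
      apply injective_projections; simpl; ring. }
    assert (HN' : ball (M := C_UniformSpace) l (eps / 2) (u (S n) - u 0%nat)%C)
      by (rewrite <- E; exact HN).
    destruct HN' as [H1 H2].
    change (Rabs (fst (u (S n) - u 0%nat)%C - fst l) < eps / 2) in H1.
    change (Rabs (snd (u (S n) - u 0%nat)%C - snd l) < eps / 2) in H2.
    eapply Rle_lt_trans; [apply Cmod_re_im_le|].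
    replace (Re (u (S n) - (u 0%nat + l))%C) with (fst (u (S n) - u 0%nat)%C - fst l)
      by (unfold Re; simpl; ring).
    replace (Im (u (S n) - (u 0%nat + l))%C) with (snd (u (S n) - u 0%nat)%C - snd l)
      by (unfold Im; simpl; ring).
    lra.
Qed.

Lemma Cmod_convex (p a b : C) (r t : R) : 0 <= t <= 1 ->
  Cmod (a - p)%C < r -> Cmod (b - p)%C < r -> Cmod (a + t * (b - a) - p)%C < r.
Proof.
  intros Ht Ha Hb.
  replace (a + t * (b - a) - p)%C with ((1 - t)%R * (a - p) + t * (b - p))%C
    by (rewrite RtoC_minus; ring).
  eapply Rle_lt_trans; [apply Cmod_triangle|].
  rewrite !Cmod_mult, !Cmod_R, !Rabs_right by lra.
  assert (0 <= Cmod (a - p)%C) by apply Cmod_ge_0.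
  assert (0 <= Cmod (b - p)%C) by apply Cmod_ge_0.
  destruct (Rle_lt_dec t (/ 2)); nra.
Qed.

(** The mean value inequality for [g z - g' xi * z], whose derivative is small near [xi] by
    continuity of [g'] there. *)
Lemma nearly_linear (g g' : C -> C) (xi : C) (rho k : R) : 0 < rho -> 0 < k ->
  (forall z, Cmod (z - xi)%C < rho -> is_Cderive g z (g' z)) -> ex_Cderive g' xi ->
  exists r, 0 < r < rho /\
    (forall z, Cmod (z - xi)%C < r -> Cmod (g' z - g' xi)%C <= k) /\
    (forall a b, Cmod (a - xi)%C < r -> Cmod (b - xi)%C < r ->
      Cmod (g b - g a - g' xi * (b - a))%C <= k * Cmod (b - a)%C).
Proof.
  intros Hrho Hk Hg [l Hl].
  destruct (is_Cderive_continuous g' xi l Hl k Hk) as [d [D1 D2]].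
  exists (Rmin (rho / 2) d). split.
  { split; [apply Rmin_pos; lra|]. eapply Rle_lt_trans; [apply Rmin_l|lra]. }
  assert (Hr : forall z, Cmod (z - xi)%C < Rmin (rho / 2) d -> Cmod (g' z - g' xi)%C <= k).
  { intros z Hz. left. apply D2. eapply Rlt_le_trans; [exact Hz|apply Rmin_r]. }
  split; [exact Hr|]. intros a b Ha Hb.
  replace (g b - g a - g' xi * (b - a))%C
    with ((g b - g' xi * b) - (g a - g' xi * a))%C by ring.
  apply (mean_value_Cmod (fun z => g z - g' xi * z)%C (fun z => g' z - g' xi)%C).
  intros t Ht. assert (Hc := Cmod_convex xi a b _ t Ht Ha Hb). split; [|now apply Hr].
  replace (g' (a + t * (b - a)) - g' xi)%C
    with (g' (a + t * (b - a)) - (0 * (a + t * (b - a)) + g' xi * 1))%C by ring.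
  apply (is_Cderive_minus g (fun z => g' xi * z)%C).
  - apply Hg. eapply Rlt_le_trans; [exact Hc|].
    eapply Rle_trans; [apply Rmin_l|lra].
  - apply (is_Cderive_mult (fun _ => g' xi) (fun z => z));
      [apply is_Cderive_const|apply is_Cderive_id].
Qed.

(** The Lipschitz bound on [psi] serves twice: it makes [psi v] close to [psi w], and it converts an
    error relative to [|psi v - psi w|] into one relative to [|v - w|]. *)
Lemma is_Cderive_inverse (g psi : C -> C) (w l : C) (m delta : R) : 0 < m -> 0 < delta ->
  is_Cderive g (psi w) l -> l <> 0%C ->
  (forall v, Cmod (v - w)%C < delta -> g (psi v) = v) ->
  (forall v, Cmod (v - w)%C < delta -> m * Cmod (psi v - psi w)%C <= Cmod (v - w)%C) ->
  is_Cderive psi w (/ l)%C.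
Proof.
  intros Hm Hdelta Hg Hl Hinv Hlip. apply is_Cderive_eps. intros eps He.
  assert (Hlp := Hl). apply Cmod_gt_0 in Hlp.
  rewrite is_Cderive_eps in Hg.
  destruct (Hg (eps * Cmod l * m)) as [d [D1 D2]];
    [repeat apply Rmult_lt_0_compat; assumption|].
  exists (Rmin delta (d * m)). split.
  { apply Rmin_pos; [assumption|now apply Rmult_lt_0_compat]. }
  intros v Hv.
  assert (V1 : Cmod (v - w)%C < delta) by (eapply Rlt_le_trans; [exact Hv|apply Rmin_l]).
  assert (V2 : Cmod (v - w)%C < d * m) by (eapply Rlt_le_trans; [exact Hv|apply Rmin_r]).
  assert (V3 := Hlip v V1).
  specialize (D2 (psi v) ltac:(nra)).
  rewrite (Hinv v V1) in D2.
  rewrite (Hinv w) in D2.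
  2:{ replace (w - w)%C with (RtoC 0) by ring. now rewrite Cmod_0. }
  replace (psi v - psi w - / l * (v - w))%C
    with (- ((v - w - l * (psi v - psi w)) / l))%C by (field; assumption).
  rewrite Cmod_opp, Cmod_div by assumption.
  apply Rmult_le_reg_r with (Cmod l); [assumption|].
  unfold Rdiv. rewrite Rmult_assoc, Rinv_l, Rmult_1_r by lra.
  eapply Rle_trans; [exact D2|].
  replace (eps * Cmod (v - w)%C * Cmod l) with (eps * Cmod l * Cmod (v - w)%C) by ring.
  rewrite Rmult_assoc. apply Rmult_le_compat_l; [nra|exact V3].
Qed.

(** Newton's iteration with the fixed slope [L = g' xi]: its map [N z = z - (g z - w) / L] halves
    distances, because [g] is within [|L| / 2] of its linear part, and its fixed point solves
    [g z = w]. *)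
Lemma local_inverse (g g' : C -> C) (xi : C) (rho : R) : 0 < rho ->
  (forall z, Cmod (z - xi)%C < rho -> is_Cderive g z (g' z)) -> ex_Cderive g' xi ->
  g' xi <> 0%C ->
  exists (r m M delta : R) (psi : C -> C), 0 < r < rho /\ 0 < m /\ 0 < M /\ 0 < delta /\
    (forall a b, Cmod (a - xi)%C < r -> Cmod (b - xi)%C < r ->
       m * Cmod (b - a)%C <= Cmod (g b - g a)%C <= M * Cmod (b - a)%C) /\
    (forall w, Cmod (w - g xi)%C < delta ->
       Cmod (psi w - xi)%C < r /\ g (psi w) = w /\
       g' (psi w) <> 0%C /\ is_Cderive psi w (/ g' (psi w))%C).
Proof.
  intros Hrho Hg Hg' HL. set (L := g' xi) in *.
  assert (HLp := HL). apply Cmod_gt_0 in HLp.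
  destruct (nearly_linear g g' xi rho (Cmod L / 2) Hrho ltac:(lra) Hg Hg')
    as [r [Hr [Hr1 Hr2]]]. fold L in Hr1, Hr2.
  assert (Hbi : forall a b, Cmod (a - xi)%C < r -> Cmod (b - xi)%C < r ->
    Cmod L / 2 * Cmod (b - a)%C <= Cmod (g b - g a)%C <= 2 * Cmod L * Cmod (b - a)%C).
  { intros a b Ha Hb. specialize (Hr2 a b Ha Hb).
    assert (T1 := Cmod_triangle_sub (L * (b - a))%C (g b - g a)%C).
    assert (T2 := Cmod_triangle_sub (g b - g a)%C (L * (b - a))%C).
    rewrite (Cmod_sub_sym (L * (b - a))%C) in T1. rewrite Cmod_mult in T1, T2.
    assert (0 <= Cmod (b - a)%C) by apply Cmod_ge_0. nra. }
  set (s := r / 2).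
  (* The condition stands under the existential so that choice yields a total [psi]; far from [g xi]
     the value [xi] is a dummy. *)
  assert (Hfix : forall w, exists z, Cmod (w - g xi)%C < Cmod L * (s / 2) ->
    Cmod (z - xi)%C < r /\ g z = w).
  { intros w. destruct (Rlt_dec (Cmod (w - g xi)%C) (Cmod L * (s / 2))) as [Hw|Hw];
      [|exists xi; tauto].
    set (N := fun z => (z - (g z - w) / L)%C).
    set (u := fun n : nat => Nat.iter n N xi).
    assert (HN : forall a b, Cmod (a - xi)%C < r -> Cmod (b - xi)%C < r ->
      Cmod (N b - N a)%C <= / 2 * Cmod (b - a)%C).
    { intros a b Ha Hb. specialize (Hr2 a b Ha Hb).
      replace (N b - N a)%C with (- ((g b - g a - L * (b - a)) / L))%C
        by (unfold N; field; assumption).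
      rewrite Cmod_opp, Cmod_div by assumption.
      apply Rmult_le_reg_r with (Cmod L); [assumption|].
      unfold Rdiv. rewrite Rmult_assoc, Rinv_l by lra. lra. }
    assert (Hx : Cmod (xi - xi)%C < r).
    { replace (xi - xi)%C with (RtoC 0) by ring. rewrite Cmod_0. lra. }
    assert (HN0 : Cmod (N xi - xi)%C < s / 2).
    { replace (N xi - xi)%C with ((w - g xi) / L)%C by (unfold N; field; assumption).
      rewrite Cmod_div by assumption.
      apply Rmult_lt_reg_r with (Cmod L); [assumption|].
      unfold Rdiv at 1. rewrite Rmult_assoc, Rinv_l by lra. lra. }
    assert (Hu : forall n, Cmod (u n - xi)%C <= s).
    { induction n as [|n IH].
      - simpl. replace (xi - xi)%C with (RtoC 0) by ring. rewrite Cmod_0. unfold s. lra.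
      - change (u (S n)) with (N (u n)).
        replace (N (u n) - xi)%C with ((N (u n) - N xi) + (N xi - xi))%C by ring.
        eapply Rle_trans; [apply Cmod_triangle|].
        assert (Hun : Cmod (u n - xi)%C < r) by (unfold s in IH; lra).
        specialize (HN xi (u n) Hx Hun). lra. }
    assert (Hur : forall n, Cmod (u n - xi)%C < r).
    { intros n. specialize (Hu n). unfold s in Hu. lra. }
    destruct (C_geometric_cauchy u s) as [z Hz].
    { induction n as [|n IH].
      - simpl. unfold s in *. lra.
      - change (u (S (S n))) with (N (u (S n))). change (u (S n)) with (N (u n)) at 2.
        specialize (HN (u n) (u (S n)) (Hur n) (Hur (S n))). simpl pow. lra. }
    exists z. intros _.
    assert (Hzr : Cmod (z - xi)%C < r).
    { destruct (Hz (s / 2) ltac:(unfold s; lra)) as [n0 Hn0].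
      specialize (Hn0 n0 (Nat.le_refl _)). rewrite Cmod_sub_sym in Hn0.
      replace (z - xi)%C with ((z - u n0) + (u n0 - xi))%C by ring.
      eapply Rle_lt_trans; [apply Cmod_triangle|]. specialize (Hu n0). unfold s in *. lra. }
    split; [assumption|].
    assert (HNz : Cmod (N z - z)%C <= 0).
    { apply le_epsilon. intros eps He. rewrite Rplus_0_l.
      destruct (Hz (eps / 2) ltac:(lra)) as [n0 Hn0].
      assert (A1 := Hn0 n0 (Nat.le_refl _)). assert (A2 := Hn0 (S n0) (Nat.le_succ_diag_r _)).
      change (u (S n0)) with (N (u n0)) in A2.
      specialize (HN (u n0) z (Hur n0) Hzr). rewrite (Cmod_sub_sym z (u n0)) in HN.
      replace (N z - z)%C with ((N z - N (u n0)) + (N (u n0) - z))%C by ring.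
      eapply Rle_trans; [apply Cmod_triangle|]. lra. }
    assert (E : (N z - z)%C = 0%C).
    { apply Cmod_eq_0, Rle_antisym; [assumption|apply Cmod_ge_0]. }
    replace (g z) with (w - L * (N z - z))%C by (unfold N; field; assumption).
    rewrite E. ring. }
  destruct (choice _ Hfix) as [psi Hpsi].
  exists r, (Cmod L / 2), (2 * Cmod L), (Cmod L * (s / 2)), psi.
  split; [assumption|]. split; [lra|]. split; [lra|]. split; [unfold s; nra|].
  split; [exact Hbi|].
  intros w Hw. destruct (Hpsi w Hw) as [W1 W2].
  assert (W3 : g' (psi w) <> 0%C).
  { apply Cmod_neq_0. specialize (Hr1 _ W1).
    assert (T := Cmod_triangle_sub L (g' (psi w))). rewrite Cmod_sub_sym in T. lra. }
  split; [assumption|]. split; [assumption|]. split; [assumption|].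
  set (dl := Cmod L * (s / 2) - Cmod (w - g xi)%C).
  assert (Hdl : forall v, Cmod (v - w)%C < dl -> Cmod (v - g xi)%C < Cmod L * (s / 2)).
  { intros v Hv. replace (v - g xi)%C with ((v - w) + (w - g xi))%C by ring.
    eapply Rle_lt_trans; [apply Cmod_triangle|]. unfold dl in Hv. lra. }
  apply (is_Cderive_inverse g psi w (g' (psi w)) (Cmod L / 2) dl); try assumption.
  - lra.
  - unfold dl. lra.
  - apply Hg. lra.
  - intros v Hv. apply Hpsi, Hdl, Hv.
  - intros v Hv. destruct (Hpsi v (Hdl v Hv)) as [V1 V2].
    destruct (Hbi (psi w) (psi v) W1 V1) as [Hb _]. now rewrite V2, W2 in Hb.
Qed.

(** * Modulus and derivative of finite Blaschke products near the circle *)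

Definition blaschke_list (l : list C) (z : C) : C :=
  fold_right (fun a p => blaschke_factor a z * p)%C (RtoC 1) l.

Definition pole_free (l : list C) (z : C) : Prop :=
  List.Forall (fun a => (1 - Cconj a * z)%C <> 0%C) l.

Lemma pole_free_near (l : list C) : List.Forall disk l ->
  exists rho, 0 < rho /\ forall z, Cmod z < 1 + rho -> pole_free l z.
Proof.
  induction 1 as [|a l Ha Hl [rho [R1 R2]]].
  - exists 1. split; [lra|]. intros z _. constructor.
  - assert (Ha0 : 0 <= Cmod a) by apply Cmod_ge_0. unfold disk in Ha.
    (* For [|z| < 2 - |a|] one has [|a| |z| <= |a| (2 - |a|) = 1 - (1 - |a|)^2 < 1]. *)
    exists (Rmin rho (1 - Cmod a)). split; [apply Rmin_pos; lra|].
    intros z Hz. constructor.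
    + apply Cmod_neq_0. eapply Rlt_le_trans; [|apply Cmod_triangle_sub].
      rewrite Cmod_1, Cmod_mult, Cmod_conj.
      assert (Hz2 : Cmod z < 1 + (1 - Cmod a)).
      { eapply Rlt_le_trans; [exact Hz|]. apply Rplus_le_compat_l, Rmin_r. }
      assert (0 <= Cmod z) by apply Cmod_ge_0. nra.
    + apply R2. eapply Rlt_le_trans; [exact Hz|]. apply Rplus_le_compat_l, Rmin_l.
Qed.

(** Outside the disk [1 - |z|^2 <= 0], so no factor has modulus below 1. This later shows that the
    local inverse maps points of the disk into the disk. *)
Lemma Cmod_blaschke_list_ge_1 (l : list C) (z : C) : List.Forall disk l -> pole_free l z ->
  1 <= Cmod z -> 1 <= Cmod (blaschke_list l z).
Proof.
  intros Hl Hp Hz. induction Hl as [|a l Ha Hl IH].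
  - simpl. rewrite Cmod_1. lra.
  - inversion_clear Hp. specialize (IH H0). simpl. rewrite Cmod_mult.
    assert (E := Cmod2_blaschke_factor_gen a z H).
    set (t := Cmod (blaschke_factor a z)) in *.
    assert (Ht : 0 <= t) by apply Cmod_ge_0.
    assert (1 - t ^ 2 <= 0).
    { rewrite E. apply Cmod_gt_0 in H. assert (Hs := Cmod_sq_lt a Ha).
      apply Rmult_le_reg_r with (Cmod (1 - Cconj a * z)%C ^ 2); [nra|].
      unfold Rdiv. rewrite Rmult_assoc, Rinv_l by nra.
      assert (1 - Cmod z ^ 2 <= 0) by nra. nra. }
    fold (blaschke_list l z). nra.
Qed.

Lemma Cmod_blaschke_list_le_1 (l : list C) (z : C) : List.Forall disk l -> disk z ->
  Cmod (blaschke_list l z) <= 1.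
Proof.
  intros Hl Hz. induction Hl as [|a l Ha Hl IH].
  - simpl. rewrite Cmod_1. lra.
  - simpl. rewrite Cmod_mult. assert (H := disk_blaschke_factor a z Ha Hz).
    unfold disk in H. assert (0 <= Cmod (blaschke_factor a z)) by apply Cmod_ge_0.
    assert (0 <= Cmod (blaschke_list l z)) by apply Cmod_ge_0.
    fold (blaschke_list l z). nra.
Qed.

Lemma Cmod_blaschke_list_boundary (l : list C) (xi : C) : List.Forall disk l ->
  Cmod xi = 1 -> Cmod (blaschke_list l xi) = 1.
Proof.
  intros Hl Hxi. induction Hl as [|a l Ha Hl IH].
  - simpl. apply Cmod_1.
  - simpl. fold (blaschke_list l xi). rewrite Cmod_mult, IH.
    assert (E := Cmod2_blaschke_factor a xi Ha ltac:(lra)). rewrite Hxi in E.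
    replace ((1 - Cmod a ^ 2) * (1 - 1 ^ 2) / Cmod (1 - Cconj a * xi)%C ^ 2) with 0 in E
      by (unfold Rdiv; ring).
    assert (0 <= Cmod (blaschke_factor a xi)) by apply Cmod_ge_0. nra.
Qed.

(* The boundary value [xi B'(xi) / B(xi) = sum_j (1 - |a_j|^2) / |xi - a_j|^2] is positive. *)
Lemma blaschke_list_derive (l : list C) : List.Forall disk l ->
  exists D : C -> C,
    (forall z, pole_free l z -> is_Cderive (blaschke_list l) z (D z) /\ ex_Cderive D z) /\
    (forall xi, Cmod xi = 1 -> exists k : R,
       (l <> nil -> 0 < k) /\ 0 <= k /\ (D xi * xi)%C = (k * blaschke_list l xi)%C).
Proof.
  induction 1 as [|a l Ha Hl [D [D1 D2]]].
  - exists (fun _ => RtoC 0). split.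
    + intros z _. split; [apply (is_Cderive_const (RtoC 1))|].
      exists (RtoC 0). apply is_Cderive_const.
    + intros xi _. exists 0. split; [congruence|]. split; [lra|]. ring.
  - set (d := fun z => ((1 - a * Cconj a) / ((1 - Cconj a * z) * (1 - Cconj a * z)))%C).
    exists (fun z => (d z * blaschke_list l z + blaschke_factor a z * D z)%C).
    split.
    + intros z Hz. inversion_clear Hz as [|? ? H0 Hz'].
      destruct (D1 z Hz') as [E1 [l2 E2]].
      assert (Eb := is_Cderive_blaschke_factor a z H0). fold (d z) in Eb.
      split.
      * apply (is_Cderive_mult (blaschke_factor a) (blaschke_list l)); assumption.
      * assert (Eden : exists l', is_Cderive (fun z => 1 - Cconj a * z)%C z l').
        { eexists. apply (is_Cderive_minus (fun _ => RtoC 1) (fun w => Cconj a * w)%C);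
            [apply is_Cderive_const|].
          apply (is_Cderive_mult (fun _ => Cconj a) (fun w => w));
            [apply is_Cderive_const|apply is_Cderive_id]. }
        destruct Eden as [l' Hl'].
        eexists. apply (is_Cderive_plus (fun z => d z * blaschke_list l z)%C).
        -- apply (is_Cderive_mult d (blaschke_list l)); [|exact E1].
           apply (is_Cderive_div (fun _ => (1 - a * Cconj a)%C)); [apply is_Cderive_const| |].
           ++ apply (is_Cderive_mult (fun z => 1 - Cconj a * z)%C (fun z => 1 - Cconj a * z)%C);
                exact Hl'.
           ++ now apply Cmult_neq_0.
        -- apply (is_Cderive_mult (blaschke_factor a) D); [exact Eb|exact E2].
    + intros xi Hxi. destruct (D2 xi Hxi) as [k [_ [K0 K1]]].
      assert (Hne : (xi - a)%C <> 0%C).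
      { apply Cmod_neq_0. eapply Rlt_le_trans; [|apply Cmod_triangle_sub].
        unfold disk in Ha. lra. }
      assert (Hne' := Hne). apply Cmod_gt_0 in Hne'.
      set (k1 := (1 - Cmod a ^ 2) / Cmod (xi - a)%C ^ 2).
      assert (Hk1 : 0 < k1) by (apply Rdiv_lt_0_compat; [now apply Cmod_sq_lt|nra]).
      exists (k1 + k). split; [lra|]. split; [lra|].
      simpl. fold (blaschke_list l xi).
      assert (Hd : (d xi * xi)%C = (k1 * blaschke_factor a xi)%C).
      { unfold k1. rewrite RtoC_div by nra. rewrite RtoC_minus, !Cmod2_conj.
        assert (Hx1 : (xi * Cconj xi)%C = 1%C) by (rewrite <- Cmod2_conj, Hxi, pow1; reflexivity).
        (* On the circle, [1 = xi * Cconj xi] turns the denominator of the factor into the conjugate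
           of its numerator, up to [xi]. *)
        assert (Hden : (1 - Cconj a * xi)%C = (xi * Cconj (xi - a))%C).
        { rewrite Cminus_conj, <- Hx1. ring. }
        assert (Hxi0 : xi <> 0%C) by (apply Cmod_neq_0; lra).
        assert (Hc : Cconj (xi - a)%C <> 0%C) by (apply Cmod_neq_0; now rewrite Cmod_conj).
        unfold d, blaschke_factor. rewrite Hden. field. repeat split; assumption. }
      rewrite RtoC_plus.
      replace ((d xi * blaschke_list l xi + blaschke_factor a xi * D xi) * xi)%C
        with ((d xi * xi) * blaschke_list l xi + blaschke_factor a xi * (D xi * xi))%C by ring.
      rewrite Hd, K1. ring.
Qed.

(** * The Cayley transform and non-tangential approach *)

(** It sends the disk to the upper half plane and [eta] to infinity; [icay] is its inverse. *)
Definition cay (eta w : C) : C := (Ci * (eta + w) / (eta - w))%C.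
Definition icay (eta W : C) : C := (eta * (W - Ci) / (W + Ci))%C.

Lemma Ci_neq_0 : Ci <> 0%C.
Proof. apply Cmod_neq_0. rewrite Cmod_Ci. lra. Qed.

Lemma two_neq_0 : RtoC 2 <> 0%C.
Proof. apply Cmod_neq_0. rewrite Cmod_R, Rabs_right; lra. Qed.

Lemma disk_neq_boundary (eta w : C) : Cmod eta = 1 -> disk w -> (eta - w)%C <> 0%C.
Proof.
  unfold disk. intros He Hw. apply Cmod_neq_0.
  eapply Rlt_le_trans; [|apply Cmod_triangle_sub]. lra.
Qed.

Lemma plus_Ci_neq_0 (W : C) : 0 < Im W -> (W + Ci)%C <> 0%C.
Proof. intros H E. apply (f_equal Im) in E. rewrite im_plus in E. simpl in E. lra. Qed.

Lemma Im_cay (eta w : C) : Cmod eta = 1 -> (eta - w)%C <> 0%C ->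
  Im (cay eta w) = (1 - Cmod w ^ 2) / Cmod (eta - w)%C ^ 2.
Proof.
  intros He H. unfold cay. rewrite Im_div by assumption. f_equal.
  replace 1 with (Cmod eta ^ 2) by (rewrite He; ring). rewrite !Cmod2_alt.
  destruct eta, w. simpl. ring.
Qed.

Lemma Cmod_cay_le (eta w : C) : Cmod eta = 1 -> disk w ->
  Cmod (cay eta w) <= 2 / Cmod (eta - w)%C.
Proof.
  intros He Hw. assert (H := disk_neq_boundary eta w He Hw). unfold cay.
  rewrite Cmod_div, Cmod_mult, Cmod_Ci, Rmult_1_l by assumption.
  apply Rmult_le_compat_r.
  - apply Rlt_le, Rinv_0_lt_compat. now apply Cmod_gt_0.
  - eapply Rle_trans; [apply Cmod_triangle|]. unfold disk in Hw. lra.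
Qed.

Lemma sub_icay (eta W : C) : (W + Ci)%C <> 0%C ->
  (eta - icay eta W)%C = (2 * Ci * eta / (W + Ci))%C.
Proof. intros H. unfold icay. field. assumption. Qed.

Lemma icay_cay (eta w : C) : eta <> 0%C -> (eta - w)%C <> 0%C -> icay eta (cay eta w) = w.
Proof.
  intros He H. unfold icay, cay.
  assert (Hd : (Ci * (eta + w) / (eta - w) + Ci)%C = (2 * Ci * eta / (eta - w))%C)
    by (field; assumption).
  rewrite Hd.
  assert (H2 := two_neq_0). assert (HC := Ci_neq_0).
  field. repeat split; assumption.
Qed.

Lemma Cmod2_icay (eta W : C) : Cmod eta = 1 -> (W + Ci)%C <> 0%C ->
  1 - Cmod (icay eta W) ^ 2 = 4 * Im W / Cmod (W + Ci)%C ^ 2.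
Proof.
  intros He H. unfold icay. rewrite Cmod_div, Cmod_mult, He, Rmult_1_l by assumption.
  assert (E : Cmod (W + Ci)%C ^ 2 - Cmod (W - Ci)%C ^ 2 = 4 * Im W).
  { rewrite !Cmod2_alt. destruct W. simpl. ring. }
  rewrite <- E. apply Cmod_gt_0 in H. field. lra.
Qed.

Lemma disk_icay (eta W : C) : Cmod eta = 1 -> 0 < Im W -> disk (icay eta W).
Proof.
  intros He HW. assert (H := plus_Ci_neq_0 W HW).
  assert (E := Cmod2_icay eta W He H).
  assert (0 < 1 - Cmod (icay eta W) ^ 2).
  { rewrite E. apply Rdiv_lt_0_compat; [lra|]. now apply pow_lt, Cmod_gt_0. }
  unfold disk. assert (0 <= Cmod (icay eta W)) by apply Cmod_ge_0. nra.
Qed.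

Lemma is_Cderive_cay (eta w : C) : (eta - w)%C <> 0%C ->
  is_Cderive (cay eta) w (2 * Ci * eta / ((eta - w) * (eta - w)))%C.
Proof.
  intros H. unfold cay.
  replace (2 * Ci * eta)%C with ((0 * (eta + w) + Ci * (0 + 1)) * (eta - w)
    - (Ci * (eta + w)) * (0 - 1))%C by ring.
  apply (is_Cderive_div (fun w => Ci * (eta + w))%C (fun w => eta - w)%C); [| |assumption].
  - apply (is_Cderive_mult (fun _ => Ci) (fun w => eta + w)%C); [apply is_Cderive_const|].
    apply (is_Cderive_plus (fun _ => eta) (fun w => w));
      [apply is_Cderive_const|apply is_Cderive_id].
  - apply (is_Cderive_minus (fun _ => eta) (fun w => w));
      [apply is_Cderive_const|apply is_Cderive_id].
Qed.

Lemma is_Cderive_icay (eta W : C) : (W + Ci)%C <> 0%C ->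
  is_Cderive (icay eta) W (2 * Ci * eta / ((W + Ci) * (W + Ci)))%C.
Proof.
  intros H. unfold icay.
  replace (2 * Ci * eta)%C with ((0 * (W - Ci) + eta * (1 - 0)) * (W + Ci)
    - (eta * (W - Ci)) * (1 + 0))%C by ring.
  apply (is_Cderive_div (fun W => eta * (W - Ci))%C (fun W => W + Ci)%C); [| |assumption].
  - apply (is_Cderive_mult (fun _ => eta) (fun W => W - Ci)%C); [apply is_Cderive_const|].
    apply (is_Cderive_minus (fun W => W) (fun _ => Ci));
      [apply is_Cderive_id|apply is_Cderive_const].
  - apply (is_Cderive_plus (fun W => W) (fun _ => Ci));
      [apply is_Cderive_id|apply is_Cderive_const].
Qed.

(** Let [t xi] be a point of the diameter at hyperbolic distance below [m] and
    [N = |1 - Cconj z t xi|]. The distance bound says [exp (- m) N^2 <= (1 - |z|^2) (1 - t^2)].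
    Since [1 - t^2 <= 2 N] and [|xi - z| <= 2 N], the constant [exp (- m) / 4] results. *)
Lemma stolz_bound (m : R) (xi z : C) : Cmod xi = 1 -> stolz m xi z -> Cmod (xi - z)%C < 1 ->
  exp (- m) / 4 * Cmod (xi - z)%C <= 1 - Cmod z ^ 2.
Proof.
  intros Hxi [Hz Hd] Hs.
  assert (Hw : exists w, diameter xi w /\ hyp_dist z w < m).
  { apply NNPP. intros N. unfold hyp_dist_set in Hd.
    destruct (Glb_Rbar_correct (fun d => exists w, diameter xi w /\ d = hyp_dist z w))
      as [_ Hg].
    apply (Rbar_lt_not_le _ _ Hd). apply Hg.
    intros d [w [W1 ->]]. simpl. apply Rnot_lt_le. intros L. apply N. now exists w. }
  destruct Hw as [w [[t [Ht ->]] Hh]].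
  assert (Htx : disk (t * xi)%C).
  { unfold disk. rewrite Cmod_mult, Cmod_R, Hxi, Rmult_1_r. apply Rabs_def1; lra. }
  assert (Htx' : Cmod (t * xi)%C <= 1) by (unfold disk in Htx; lra).
  assert (Hb := disk_blaschke_factor z _ Hz Htx).
  assert (E := Cmod2_blaschke_factor z _ Hz Htx').
  assert (Hn := disk_denom_neq_0 z _ Hz Htx').
  unfold hyp_dist in Hh.
  replace ((z - t * xi) / (1 - Cconj z * (t * xi)))%C
    with (- blaschke_factor z (t * xi))%C in Hh
    by (unfold blaschke_factor; field; exact Hn).
  rewrite Cmod_opp in Hh. unfold artanh in Hh.
  set (dl := Cmod (blaschke_factor z (t * xi))) in *.
  assert (Hd0 : 0 <= dl) by apply Cmod_ge_0.
  assert (Hd1 : dl < 1) by exact Hb.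
  assert (Hq : 0 < (1 + dl) / (1 - dl)) by (apply Rdiv_lt_0_compat; lra).
  assert (Hk : exp (- m) <= 1 - dl ^ 2).
  { assert (H1 : (1 + dl) / (1 - dl) < exp m).
    { rewrite <- (exp_ln _ Hq). apply exp_increasing. lra. }
    apply Rmult_lt_compat_r with (r := 1 - dl) in H1; [|lra].
    unfold Rdiv in H1. rewrite Rmult_assoc, Rinv_l, Rmult_1_r in H1 by lra.
    rewrite exp_Ropp. assert (Hm := exp_pos m).
    apply Rmult_le_reg_l with (exp m); [assumption|]. rewrite Rinv_r by lra. nra. }
  rewrite E in Hk. rewrite Cmod_mult, Cmod_R, Hxi, Rmult_1_r, pow2_abs in Hk.
  set (k := exp (- m)) in *. assert (Hkp : 0 < k) by apply exp_pos.
  set (N := Cmod (1 - Cconj z * (t * xi))%C) in *.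
  assert (HN : 0 < N) by now apply Cmod_gt_0.
  assert (Hk2 : k * N ^ 2 <= (1 - Cmod z ^ 2) * (1 - t ^ 2)).
  { apply Rmult_le_compat_r with (r := N ^ 2) in Hk; [|nra].
    unfold Rdiv in Hk. rewrite Rmult_assoc, Rinv_l in Hk by nra. lra. }
  (* Rotation of [xi] to 1, up to conjugation: [|xi - z| = |1 - zeta|] and [N = |1 - t zeta|]. *)
  set (zeta := (Cconj z * xi)%C).
  assert (Hzeta : Cmod zeta < 1).
  { unfold zeta. rewrite Cmod_mult, Cmod_conj, Hxi, Rmult_1_r. exact Hz. }
  assert (HNe : N = Cmod (1 - t * zeta)%C) by (unfold N, zeta; f_equal; ring).
  assert (Hs' : Cmod (xi - z)%C = Cmod (1 - zeta)%C).
  { transitivity (Cmod (Cconj (xi - z) * xi)%C).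
    - rewrite Cmod_mult, Cmod_conj, Hxi. ring.
    - f_equal. rewrite Cminus_conj. unfold zeta.
      replace (RtoC 1) with (xi * Cconj xi)%C
        by (rewrite <- Cmod2_conj, Hxi, pow1; reflexivity).
      ring. }
  rewrite Hs' in *.
  assert (HN1 : 1 - Rabs t <= N).
  { rewrite HNe. eapply Rle_trans; [|apply Cmod_triangle_sub].
    rewrite Cmod_1, Cmod_mult, Cmod_R.
    assert (0 <= Rabs t) by apply Rabs_pos. assert (0 <= Cmod zeta) by apply Cmod_ge_0. nra. }
  assert (Ht2 : 1 - t ^ 2 <= 2 * N).
  { rewrite <- pow2_abs. assert (0 <= Rabs t) by apply Rabs_pos. nra. }
  assert (Hz2 := Cmod_sq_lt z Hz).
  assert (HkN : k * N <= 2 * (1 - Cmod z ^ 2)).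
  { apply Rmult_le_reg_r with N; [assumption|]. nra. }
  assert (H2N : Cmod (1 - zeta)%C <= 2 * N).
  { destruct (Rle_lt_dec 0 t) as [Ht0|Ht0].
    - replace (1 - zeta)%C with ((1 - t * zeta) - (1 - t)%R * zeta)%C
        by (rewrite RtoC_minus; ring).
      eapply Rle_trans; [apply Cmod_sub_le|]. rewrite <- HNe.
      rewrite Cmod_mult, Cmod_R, Rabs_right by lra.
      rewrite Rabs_right in HN1 by lra. assert (0 <= Cmod zeta) by apply Cmod_ge_0. nra.
    (* The region [stolz] also reaches [- xi]; nearness to [xi] handles negative [t], because
       [Re zeta > 0] forces [N >= 1]. *)
    - assert (Hre : 0 < Re zeta).
      { assert (Hr := re_le_Cmod (1 - zeta)%C).
        replace (Re (1 - zeta)%C) with (1 - Re zeta) in Hr by (destruct zeta; simpl; ring).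
        assert (H1 := Rle_abs (1 - Re zeta)). lra. }
      assert (HN2 : 1 <= N).
      { rewrite HNe. eapply Rle_trans; [|apply re_le_Cmod].
        replace (Re (1 - t * zeta)%C) with (1 - t * Re zeta) by (destruct zeta; simpl; ring).
        eapply Rle_trans; [|apply Rle_abs]. nra. }
      lra. }
  nra.
Qed.

Lemma Im_minus (a b : C) : Im (a - b)%C = Im a - Im b.
Proof. destruct a, b. reflexivity. Qed.

Lemma eventually_near (z : nat -> C) (xi : C) :
  filterlim z eventually (locally xi) ->
  forall eps, 0 < eps -> eventually (fun n => Cmod (xi - z n)%C < eps).
Proof.
  intros H eps He.
  destruct (proj1 (filterlim_locally _ _) H (mkposreal (eps / 2) ltac:(lra))) as [N HN].
  exists N. intros n Hn. destruct (HN n Hn) as [H1 H2].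
  change (Rabs (fst (z n) - fst xi) < eps / 2) in H1.
  change (Rabs (snd (z n) - snd xi) < eps / 2) in H2.
  rewrite Cmod_sub_sym. eapply Rle_lt_trans; [apply Cmod_re_im_le|].
  change (Rabs (fst (z n) - fst xi) + Rabs (snd (z n) - snd xi) < eps). lra.
Qed.

(** A single factor suffices, the others having modulus at most 1; the 4 comes from
    [|1 - Cconj a z| <= 2]. It makes the image of a non-tangential sequence non-tangential. *)
Lemma blaschke_boundary_lower (c : C) (l : list C) : Cmod c = 1 -> List.Forall disk l ->
  l <> nil -> exists k, 0 < k /\
    forall z, disk z -> k * (1 - Cmod z ^ 2) <= 1 - Cmod (c * blaschke_list l z)%C ^ 2.
Proof.
  intros Hc Hl Hn. destruct Hl as [|a l Ha Hl]; [congruence|].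
  exists ((1 - Cmod a ^ 2) / 4). assert (Ha2 := Cmod_sq_lt a Ha). split; [lra|].
  intros z Hz. simpl. fold (blaschke_list l z).
  rewrite !Cmod_mult, Hc, Rmult_1_l.
  assert (E := Cmod2_blaschke_factor a z Ha ltac:(unfold disk in Hz; lra)).
  assert (H1 := Cmod_blaschke_list_le_1 l z Hl Hz).
  assert (Hn0 := disk_denom_neq_0 a z Ha ltac:(unfold disk in Hz; lra)).
  assert (H4 : Cmod (1 - Cconj a * z)%C <= 2).
  { eapply Rle_trans; [apply Cmod_sub_le|]. rewrite Cmod_1, Cmod_mult, Cmod_conj.
    unfold disk in Ha, Hz. assert (0 <= Cmod a) by apply Cmod_ge_0.
    assert (0 <= Cmod z) by apply Cmod_ge_0. nra. }
  apply Cmod_gt_0 in Hn0. assert (Hz2 := Cmod_sq_lt z Hz).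
  set (b := Cmod (blaschke_factor a z)) in *. set (p := Cmod (blaschke_list l z)) in *.
  set (d := Cmod (1 - Cconj a * z)%C) in *.
  assert (0 <= b) by apply Cmod_ge_0. assert (0 <= p) by apply Cmod_ge_0.
  apply Rle_trans with (1 - b ^ 2).
  - rewrite E. apply Rmult_le_reg_r with (d ^ 2); [nra|].
    unfold Rdiv at 2. rewrite (Rmult_assoc _ (/ _)), Rinv_l, Rmult_1_r by nra.
    assert (0 < (1 - Cmod a ^ 2) * (1 - Cmod z ^ 2)) by (apply Rmult_lt_0_compat; lra).
    assert (d ^ 2 <= 4) by nra. nra.
  - assert (p ^ 2 <= 1) by nra. nra.
Qed.

(** * [B] as a local coordinate at [xi], and the transfer of half-plane rigidity to the disk *)

Theorem corollary1p2 (B f : C -> C)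
  (hB : finite_blaschke_product B)
  (hf : self_map_disk f)
  (hmax : maximal_blaschke_product B f)
  (xi : C) (hxi : Cmod xi = 1)
  (z : nat -> C) (hz : forall n : nat, disk (z n))
  (hlim : nontangential_lim z xi)
  (ho : is_domin (U := R_NormedModule) (V := C_NormedModule) eventually
          (fun n => Cmod (xi - z n)%C ^ 3) (fun n => (f (z n) - B (z n))%C)) :
  forall w : C, disk w -> f w = B w.
Proof.
  destruct hB as [c [l [Hc [Hl HB]]]].
  destruct hmax as [_ [HBs [Hcrit Hmax]]].
  destruct hlim as [Hlim [m0 [Hm0 Hst]]].
  set (g := fun z => (c * blaschke_list l z)%C).
  assert (HBg : forall z, disk z -> B z = g z) by exact HB.
  assert (Hln : l <> nil).
  { intros ->. assert (D0 : disk 0%C) by (unfold disk; rewrite Cmod_0; lra).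
    assert (H := proj2 HBs 0%C D0). rewrite HBg in H by assumption. unfold g, disk in H.
    simpl in H. rewrite Cmult_1_r, Hc in H. lra. }
  destruct (blaschke_list_derive l Hl) as [D [HD1 HD2]].
  destruct (pole_free_near l Hl) as [rho [Hrho Hpf]].
  assert (Hg : forall z, Cmod z < 1 + rho -> is_Cderive g z (c * D z)%C).
  { intros u Hu. replace (c * D u)%C with (0 * blaschke_list l u + c * D u)%C by ring.
    apply (is_Cderive_mult (fun _ => c) (blaschke_list l)); [apply is_Cderive_const|].
    now apply HD1, Hpf. }
  assert (Hball : forall u, Cmod (u - xi)%C < rho -> Cmod u < 1 + rho).
  { intros u Hu. assert (H := Cmod_triangle_sub u xi). lra. }
  assert (Hgne : (c * D xi)%C <> 0%C).
  { destruct (HD2 xi hxi) as [k [K0 [_ K1]]]. specialize (K0 Hln).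
    apply Cmod_neq_0. rewrite Cmod_mult, Hc, Rmult_1_l.
    apply (f_equal Cmod) in K1.
    rewrite !Cmod_mult, hxi, Rmult_1_r, Cmod_R, Cmod_blaschke_list_boundary, Rmult_1_r in K1
      by assumption.
    rewrite K1. rewrite Rabs_right; lra. }
  destruct (local_inverse g (fun z => c * D z)%C xi rho Hrho) as
    (r & m & M & delta & psi & Hr & Hm & HM & Hdelta & Hbi & Hpsi).
  { intros u Hu. now apply Hg, Hball. }
  { destruct (HD1 xi ltac:(apply Hpf; lra)) as [_ [l' Hl']].
    eexists. apply (is_Cderive_mult (fun _ => c) D); [apply is_Cderive_const|exact Hl']. }
  { exact Hgne. }
  set (eta := g xi) in *.
  assert (Heta : Cmod eta = 1).
  { unfold eta, g. rewrite Cmod_mult, Hc, Cmod_blaschke_list_boundary by assumption. ring. }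
  assert (Heta0 : eta <> 0%C) by (apply Cmod_neq_0; lra).
  assert (Hgd : forall u, disk u -> disk (g u)).
  { intros u Hu. rewrite <- HBg by assumption. now apply (proj2 HBs). }
  assert (Hr0 : Cmod (xi - xi)%C < r).
  { replace (xi - xi)%C with (RtoC 0) by ring. rewrite Cmod_0. lra. }
  (* The lower Lipschitz bound makes [g] injective near [xi], so [psi] is also a left inverse. *)
  assert (Hpsig : forall u, Cmod (u - xi)%C < r -> Cmod (g u - eta)%C < delta ->
    psi (g u) = u).
  { intros u Hu Hgu. destruct (Hpsi (g u) Hgu) as [P1 [P2 _]].
    destruct (Hbi u (psi (g u)) Hu P1) as [Q _]. rewrite P2 in Q.
    replace (g u - g u)%C with (RtoC 0) in Q by ring. rewrite Cmod_0 in Q.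
    assert (E : Cmod (psi (g u) - u)%C = 0)
      by (generalize (Cmod_ge_0 (psi (g u) - u)%C); nra).
    apply Cmod_eq_0 in E. replace (psi (g u)) with (psi (g u) - u + u)%C by ring.
    rewrite E. ring. }
  (* [|eta - icay eta W| = 2 / |W + i|], which is below [delta] once [Im W > 2 / delta]. *)
  set (R0 := 2 / delta).
  assert (HR0 : 0 <= R0) by (unfold R0; apply Rlt_le, Rdiv_lt_0_compat; lra).
  assert (Hnear : forall W, R0 < Im W -> Cmod (icay eta W - eta)%C < delta).
  { intros W HW. assert (HW0 := plus_Ci_neq_0 W ltac:(lra)).
    rewrite Cmod_sub_sym, sub_icay by assumption.
    rewrite Cmod_div, !Cmod_mult, Cmod_Ci, Heta, Cmod_R, Rabs_right, !Rmult_1_r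
      by lra || assumption.
    assert (HI := Im_le_Cmod (W + Ci)%C). rewrite im_plus in HI. simpl in HI.
    apply Cmod_gt_0 in HW0.
    apply Rmult_lt_reg_r with (Cmod (W + Ci)%C); [assumption|].
    unfold Rdiv. rewrite Rmult_assoc, Rinv_l, Rmult_1_r by lra.
    assert (HR1 : R0 * delta = 2) by (unfold R0; field; lra). nra. }
  (* In this parametrization of the disk near [xi], [cay eta] composed with [B] is the identity and
     composed with [f] is [phi]. *)
  set (u := fun W => psi (icay eta W)).
  assert (Hu : forall W, R0 < Im W -> disk (u W) /\ g (u W) = icay eta W).
  { intros W HW. destruct (Hpsi _ (Hnear W HW)) as [P1 [P2 _]]. fold (u W) in P1, P2.
    split; [|assumption].
    (* A Blaschke product has modulus at least 1 outside the disk. *)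
    unfold disk. apply Rnot_le_lt. intros H1.
    assert (H2 : 1 <= Cmod (g (u W))).
    { unfold g. rewrite Cmod_mult, Hc, Rmult_1_l.
      apply Cmod_blaschke_list_ge_1; [assumption| |assumption].
      apply Hpf, Hball. lra. }
    rewrite P2 in H2. assert (H3 := disk_icay eta W Heta ltac:(lra)). unfold disk in H3. lra. }
  set (phi := fun W => cay eta (f (u W))).
  set (phi' := fun W => (2 * Ci * eta / ((eta - f (u W)) * (eta - f (u W)))
    * (C_derive f (u W) * (/ (c * D (u W)) * (2 * Ci * eta / ((W + Ci) * (W + Ci))))))%C).
  assert (Hfu : forall W, R0 < Im W -> (eta - f (u W))%C <> 0%C).
  { intros W HW. apply disk_neq_boundary; [assumption|]. apply (proj2 hf). now apply Hu. }
  assert (Hpos : forall W, R0 < Im W -> 0 < Im (phi W)).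
  { intros W HW. unfold phi. rewrite Im_cay by (assumption || now apply Hfu).
    apply Rdiv_lt_0_compat.
    - apply Cmod_sq_lt, (proj2 hf). now apply Hu.
    - apply pow_lt, Cmod_gt_0. now apply Hfu. }
  assert (Hder : forall W, R0 < Im W -> is_Cderive phi W (phi' W)).
  { intros W HW. destruct (Hu W HW) as [U1 U2].
    destruct (Hpsi _ (Hnear W HW)) as [_ [_ [_ P4]]].
    apply (is_Cderive_comp (cay eta) (fun W => f (u W))).
    - apply is_Cderive_cay. now apply Hfu.
    - apply (is_Cderive_comp f u).
      + apply C_derive_correct; [exact (u W)|]. now apply (proj1 hf).
      + apply (is_Cderive_comp psi (icay eta)); [exact P4|].
        apply is_Cderive_icay, plus_Ci_neq_0. lra. }
  assert (Hcontr : forall W, R0 < Im W -> Cmod (phi' W) * Im W <= Im (phi W)).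
  { intros W HW. destruct (Hu W HW) as [U1 U2].
    destruct (Hpsi _ (Hnear W HW)) as [_ [_ [P3 _]]]. fold (u W) in P3.
    (* At [u W], [1 - |B|^2 = 4 Im W / |W + i|^2]. The derivatives of [cay eta] and [icay eta]
       supply the remaining factors, so the claim is this inequality rewritten in half-plane
       coordinates. *)
    assert (Hh := Hmax f hf Hcrit (u W) U1). unfold hyp_deriv in Hh.
    assert (HCB : C_derive B (u W) = (c * D (u W))%C).
    { apply is_C_derive_unique.
      (* [B] agrees with [g] only in the disk, and the ball of this radius about [u W] stays inside
         it. *)
      apply (is_Cderive_ext_loc g B _ _ (1 - Cmod (u W))).
      - unfold disk in U1. lra.
      - intros v Hv. symmetry. apply HBg. unfold disk.
        assert (H := Cmod_triangle_sub v (u W)). lra.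
      - apply Hg. unfold disk in U1. lra. }
    rewrite HCB, HBg, U2 in Hh by assumption.
    assert (HW0 := plus_Ci_neq_0 W ltac:(lra)).
    rewrite Cmod2_icay in Hh by assumption.
    assert (Hf1 := Cmod_sq_lt _ (proj2 hf _ U1)).
    assert (HfW := Hfu W HW).
    unfold phi. rewrite Im_cay by assumption. unfold phi'.
    rewrite Cmod_mult, (Cmod_div _ _ (Cmult_neq_0 _ _ HfW HfW)), (Cmod_mult (C_derive f (u W))),
      (Cmod_mult (/ _)%C), (Cmod_inv _ P3), (Cmod_div _ _ (Cmult_neq_0 _ _ HW0 HW0)).
    rewrite !Cmod_mult, Cmod_Ci, Heta, Cmod_R, Rabs_right by lra.
    rewrite Cmod_mult in Hh.
    assert (P3' := P3). apply Cmod_gt_0 in P3'. rewrite Cmod_mult in P3'.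
    apply Cmod_gt_0 in HW0, HfW.
    set (a := Cmod (C_derive f (u W))) in *. set (b := Cmod c * Cmod (D (u W))) in *.
    set (x := Cmod (eta - f (u W))%C) in *. set (y := Cmod (W + Ci)%C) in *.
    set (p := 1 - Cmod (f (u W)) ^ 2) in *. set (v := Im W) in *.
    assert (Hv : 0 < v) by lra.
    assert (Hq : a * (4 * v) <= b * (p * y ^ 2)).
    { apply Rmult_le_compat_r with (r := p * (4 * v)) in Hh; [|nra].
      replace (a / p * (p * (4 * v))) with (a * (4 * v)) in Hh by (field; lra).
      replace (b / (4 * v / y ^ 2) * (p * (4 * v))) with (b * (p * y ^ 2)) in Hh
        by (field; lra).
      exact Hh. }
    replace (2 * 1 * 1 / (x * x) * (a * (/ b * (2 * 1 * 1 / (y * y)))) * v)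
      with (a * (4 * v) * / (x ^ 2 * b * y ^ 2)) by (field; lra).
    replace (p / x ^ 2) with (b * (p * y ^ 2) * / (x ^ 2 * b * y ^ 2)) by (field; lra).
    apply Rmult_le_compat_r; [|exact Hq].
    apply Rlt_le, Rinv_0_lt_compat.
    assert (0 < x ^ 2) by nra. assert (0 < y ^ 2) by nra. assert (0 < x ^ 2 * b) by nra. nra. }
  destruct (blaschke_boundary_lower c l Hc Hl Hln) as [k1 [Hk1 Hk1']].
  set (k2 := exp (- m0) / 4).
  assert (Hk2 : 0 < k2) by (unfold k2; generalize (exp_pos (- m0)); lra).
  assert (Hseq : forall s0 e, 0 < s0 -> 0 < e -> exists v, disk v /\ Cmod (xi - v)%C < s0 /\
    k2 * Cmod (xi - v)%C <= 1 - Cmod v ^ 2 /\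
    Cmod (f v - g v)%C <= e * Cmod (xi - v)%C ^ 3).
  { intros s0 e Hs0 He.
    destruct (filter_and _ _ Hst (filter_and _ _ (ho (mkposreal e He))
      (filter_and _ _ (eventually_near z xi Hlim s0 Hs0)
        (eventually_near z xi Hlim 1 Rlt_0_1)))) as [N HN].
    destruct (HN N (Nat.le_refl _)) as [N1 [N2 [N3 N4]]].
    exists (z N). split; [apply hz|]. split; [assumption|]. split; [now apply stolz_bound|].
    rewrite <- HBg by apply hz.
    change (Cmod (f (z N) - B (z N))%C <= e * Rabs (Cmod (xi - z N)%C ^ 3)) in N2.
    rewrite Rabs_right in N2 by (apply Rle_ge, pow_le, Cmod_ge_0). exact N2. }
  (* The quotient of the bounds [|cay eta (g v)| <= 2 / (m s)] and
     [Im (cay eta (g v)) >= k1 k2 / (M^2 s)], where [s = |xi - v|]. *)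
  set (K := 2 * M ^ 2 / (m * (k1 * k2))).
  assert (Hk12 : 0 < k1 * k2) by now apply Rmult_lt_0_compat.
  assert (Hwn : forall A eps, 0 < eps -> exists v, disk v /\ Cmod (v - xi)%C < r /\
    A < Im (cay eta (g v)) /\ Cmod (cay eta (g v)) <= K * Im (cay eta (g v)) /\
    Cmod (cay eta (g v)) * Cmod (cay eta (f v) - cay eta (g v))%C <= eps).
  { intros A eps He.
    (* The first entry keeps [|eta - f v| >= m s / 2], as [|eta - g v| >= m s]. The product to be
       bounded is then at most [2 / (m s)] times [2 e s^3 / (m s / 2 * m s)], that is
       [8 e / m^3]. *)
    set (e := Rmin (m / 2) (eps * m ^ 3 / 8)).
    assert (Hm3 : 0 < m ^ 3) by now apply pow_lt.
    assert (He' : 0 < e) by (apply Rmin_pos; [lra|]; apply Rdiv_lt_0_compat; nra).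
    assert (E1 : e <= m / 2) by apply Rmin_l.
    assert (E2 : e <= eps * m ^ 3 / 8) by apply Rmin_r.
    assert (HA : 0 <= Rabs A) by apply Rabs_pos.
    assert (HM2 : 0 < M ^ 2) by now apply pow_lt.
    (* The last entry makes the lower bound [k1 k2 / (M^2 s)] for the height exceed [A]. *)
    set (s0 := Rmin (Rmin r 1) (k1 * k2 / (M ^ 2 * (Rabs A + 1)))).
    assert (Hs0 : 0 < s0).
    { repeat apply Rmin_pos; try lra. apply Rdiv_lt_0_compat; [assumption|]. nra. }
    destruct (Hseq s0 e Hs0 He') as [v [V1 [V2 [V3 V4]]]].
    exists v. split; [assumption|].
    assert (Hvr : Cmod (v - xi)%C < r).
    { rewrite Cmod_sub_sym. eapply Rlt_le_trans; [exact V2|].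
      eapply Rle_trans; apply Rmin_l. }
    split; [assumption|].
    assert (S1 : Cmod (xi - v)%C < 1).
    { eapply Rlt_le_trans; [exact V2|]. eapply Rle_trans; [apply Rmin_l|apply Rmin_r]. }
    assert (S2 : Cmod (xi - v)%C < k1 * k2 / (M ^ 2 * (Rabs A + 1))).
    { eapply Rlt_le_trans; [exact V2|]. apply Rmin_r. }
    assert (Hs : 0 < Cmod (xi - v)%C) by now apply Cmod_gt_0, disk_neq_boundary.
    destruct (Hbi v xi Hvr Hr0) as [B1 B2]. fold eta in B1, B2.
    assert (Hgv := disk_neq_boundary eta (g v) Heta (Hgd v V1)).
    assert (Hfv := disk_neq_boundary eta (f v) Heta (proj2 hf v V1)).
    assert (F1 := Cmod_triangle_sub (eta - g v)%C (f v - g v)%C).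
    replace (eta - g v - (f v - g v))%C with (eta - f v)%C in F1 by ring.
    specialize (Hk1' v V1). fold (g v) in Hk1'.
    assert (W1 := Cmod_cay_le eta (g v) Heta (Hgd v V1)).
    assert (Ediff : (cay eta (f v) - cay eta (g v))%C
      = (2 * Ci * eta * (f v - g v) / ((eta - f v) * (eta - g v)))%C).
    { unfold cay. field. split; assumption. }
    rewrite Ediff, Im_cay by assumption.
    rewrite Cmod_div, !Cmod_mult, Cmod_Ci, Heta, Cmod_R, (Rabs_right 2)
      by (lra || now apply Cmult_neq_0).
    clear Ediff. apply Cmod_gt_0 in Hgv, Hfv.
    set (s := Cmod (xi - v)%C) in *. set (x := Cmod (eta - g v)%C) in *.
    set (y := Cmod (eta - f v)%C) in *. set (d := Cmod (f v - g v)%C) in *.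
    set (p := 1 - Cmod (g v) ^ 2) in *. set (w := Cmod (cay eta (g v))) in *.
    assert (Hw0 : 0 <= w) by apply Cmod_ge_0. assert (Hd0 : 0 <= d) by apply Cmod_ge_0.
    assert (Hp : k1 * k2 * s <= p) by nra.
    assert (Hms : 0 < m * s) by now apply Rmult_lt_0_compat.
    assert (Hw2 : w <= 2 / (m * s)).
    { eapply Rle_trans; [exact W1|]. apply Rmult_le_compat_l; [lra|].
      now apply Rinv_le_contravar. }
    assert (Hx2 : x ^ 2 <= M ^ 2 * s ^ 2).
    { rewrite <- Rpow_mult_distr. apply pow_incr. lra. }
    assert (Hp2 : k1 * k2 / (M ^ 2 * s) <= p / x ^ 2).
    { apply Rmult_le_reg_r with (x ^ 2); [nra|].
      replace (p / x ^ 2 * x ^ 2) with p by (field; lra).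
      apply Rle_trans with (k1 * k2 / (M ^ 2 * s) * (M ^ 2 * s ^ 2)).
      - apply Rmult_le_compat_l; [|assumption].
        apply Rlt_le, Rdiv_lt_0_compat; nra.
      - replace (k1 * k2 / (M ^ 2 * s) * (M ^ 2 * s ^ 2)) with (k1 * k2 * s)
          by (field; lra). exact Hp. }
    split; [|split].
    - eapply Rlt_le_trans; [|exact Hp2].
      apply Rle_lt_trans with (Rabs A); [apply Rle_abs|].
      apply Rmult_lt_reg_r with (M ^ 2 * s); [nra|].
      replace (k1 * k2 / (M ^ 2 * s) * (M ^ 2 * s)) with (k1 * k2) by (field; lra).
      apply Rmult_lt_compat_r with (r := M ^ 2 * (Rabs A + 1)) in S2; [|nra].
      replace (k1 * k2 / (M ^ 2 * (Rabs A + 1)) * (M ^ 2 * (Rabs A + 1))) with (k1 * k2) in S2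
        by (field; lra).
      nra.
    - eapply Rle_trans; [exact Hw2|].
      apply Rle_trans with (K * (k1 * k2 / (M ^ 2 * s))).
      + right. unfold K. field. lra.
      + apply Rmult_le_compat_l; [|exact Hp2]. unfold K.
        apply Rlt_le, Rdiv_lt_0_compat; nra.
    - assert (Hd : d <= e * s ^ 2 * s) by (simpl in V4 |- *; lra).
      assert (Hs2 : s ^ 2 <= 1) by nra.
      assert (Hes : e * s ^ 2 <= m / 2) by nra.
      assert (Hy : m * s / 2 <= y) by nra.
      apply Rle_trans with (2 / (m * s) * (2 * 1 * 1 * (e * s ^ 3) / (m * s / 2 * (m * s)))).
      + apply Rmult_le_compat; [assumption| |assumption|].
        * apply Rmult_le_pos; [lra|]. apply Rlt_le, Rinv_0_lt_compat.
          now apply Rmult_lt_0_compat.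
        * apply Rmult_le_compat; [lra| |lra|].
          -- apply Rlt_le, Rinv_0_lt_compat. now apply Rmult_lt_0_compat.
          -- apply Rinv_le_contravar; [nra|]. apply Rmult_le_compat; lra.
      + replace (2 / (m * s) * (2 * 1 * 1 * (e * s ^ 3) / (m * s / 2 * (m * s))))
          with (e * (8 / m ^ 3)) by (field; lra).
        apply Rle_trans with (eps * m ^ 3 / 8 * (8 / m ^ 3)).
        * apply Rmult_le_compat_r; [|exact E2]. apply Rlt_le, Rdiv_lt_0_compat; lra.
        * right. field. lra. }
  assert (Huv : forall v, disk v -> Cmod (v - xi)%C < r -> R0 < Im (cay eta (g v)) ->
    u (cay eta (g v)) = v).
  { intros v V1 V2 V3. assert (H := Hnear _ V3). unfold u.
    rewrite icay_cay in H |- * by (assumption || now apply disk_neq_boundary, Hgd).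
    now apply Hpsig. }
  assert (Hphi : forall W, R0 < Im W -> phi W = W).
  { apply (half_plane_rigidity phi phi' R0 HR0 Hpos Hder Hcontr K).
    intros A eps He.
    destruct (Hwn (Rmax A R0) eps He) as [v [V1 [V2 [V3 [V4 V5]]]]].
    assert (A1 : A < Im (cay eta (g v))) by (eapply Rle_lt_trans; [apply Rmax_l|exact V3]).
    assert (A2 : R0 < Im (cay eta (g v))) by (eapply Rle_lt_trans; [apply Rmax_r|exact V3]).
    exists (cay eta (g v)). repeat split; try assumption.
    unfold phi. now rewrite Huv. }
  (* One term of the sequence, high enough in the half plane, is the centre of a small disk on which
     [f = B]: by continuity the nearby points stay above [R0] and within [r] of [xi]. *)
  destruct (Hwn R0 1 Rlt_0_1) as [v [V1 [V2 [V3 _]]]].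
  assert (Hcg : is_Cderive (fun t => cay eta (g t)) v
    (2 * Ci * eta / ((eta - g v) * (eta - g v)) * (c * D v))%C).
  { apply (is_Cderive_comp (cay eta) g).
    - now apply is_Cderive_cay, disk_neq_boundary, Hgd.
    - apply Hg. unfold disk in V1. lra. }
  destruct (is_Cderive_continuous _ _ _ Hcg (Im (cay eta (g v)) - R0) ltac:(lra))
    as [d [D1 D2]].
  apply (identity_principle f B v (Rmin d (r - Cmod (v - xi)%C)) hf HBs V1).
  { apply Rmin_pos; lra. }
  intros t T1 T2. rewrite HBg by assumption.
  assert (T3 : Cmod (t - v)%C < d) by (eapply Rlt_le_trans; [exact T2|apply Rmin_l]).
  assert (T4 : Cmod (t - v)%C < r - Cmod (v - xi)%C)
    by (eapply Rlt_le_trans; [exact T2|apply Rmin_r]).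
  assert (T5 : Cmod (t - xi)%C < r).
  { replace (t - xi)%C with ((t - v) + (v - xi))%C by ring.
    eapply Rle_lt_trans; [apply Cmod_triangle|]. lra. }
  specialize (D2 t T3).
  assert (T6 : R0 < Im (cay eta (g t))).
  { assert (H := Im_abs_le_Cmod (cay eta (g t) - cay eta (g v))%C).
    apply Rabs_le_between in H. rewrite Im_minus in H. lra. }
  assert (H := Hphi _ T6). unfold phi in H. rewrite Huv in H by assumption.
  apply (f_equal (icay eta)) in H.
  rewrite !icay_cay in H
    by (assumption || (apply disk_neq_boundary; [assumption|]; now apply Hgd || now apply (proj2 hf))).
  exact H.
Qed.
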